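(* Let $X$ be a topological toric manifold of dimension $2n$ and let $J$ be a $(\mathbb{C}^* )^n$-invariant almost complex structure on $X$. Then $J$ is integrable, and $X$ (with the complex structure given by $J$) is weakly equivariantly isomorphic to a toric manifold. Namely, there are a toric manifold $Y$ (of complex dimension $n$, with its $(\mathbb{C}^* )^n$-action), a biholomorphism $f : X \to Y$ and a smooth group automorphism $\rho$ of $(\mathbb{C}^* )^n$ such that $f(g \cdot x) = \rho(g) \cdot f(x)$ for all $g \in (\mathbb{C}^* )^n$ and all $x \in X$.
   Context: $\mathbb{C}^* = \mathbb{C} \setminus \{0\}$; a smooth automorphism of $(\mathbb{C}^* )^n$ is an automorphism of $(\mathbb{C}^* )^n$ as a real Lie group (not necessarily holomorphic or algebraic). A topological toric manifold of dimension $2n$ is a smooth closed (compact, without boundary) manifold $X$ of real dimension $2n$ endowed with an effective smooth action of $(\mathbb{C}^* )^n$ which has an open dense orbit and which is locally equivariantly diffeomorphic to a smooth representation space of $(\mathbb{C}^* )^n$. That is, $X$ is covered by finitely many $(\mathbb{C}^* )^n$-invariant open subsets, each equivariantly diffeomorphic to a direct sum $\bigoplus_{i=1}^n V(\chi_i)$ of complex one-dimensional representation spaces, where each $\chi_i : (\mathbb{C}^* )^n \to \mathbb{C}^*$ is a smooth (not necessarily holomorphic or algebraic) group homomorphism and $V(\chi_i)$ is $\mathbb{C}$ with $g$ acting by multiplication by $\chi_i(g)$. A $(\mathbb{C}^* )^n$-invariant almost complex structure on $X$ is a smooth bundle endomorphism $J$ of $TX$ covering the identity, with $J^2 = -\mathrm{id}$,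 commuting with the differential of the action of every $g \in (\mathbb{C}^* )^n$. It is integrable if it is induced by a complex manifold structure on $X$. A toric manifold is a nonsingular complete toric variety over $\mathbb{C}$, regarded as a compact complex manifold with the algebraic action of its torus $(\mathbb{C}^* )^n$. *)

(* Defs.v *)
From HB Require Import structures.
From mathcomp Require Import all_boot all_order all_algebra.
From mathcomp Require Import complex.
From mathcomp Require Import all_classical all_reals all_analysis.
Import Order.TTheory GRing.Theory Num.Theory numFieldNormedType.Exports.

Set Implicit Arguments.
Unset Strict Implicit.
Unset Printing Implicit Defensive.

Local Open Scope classical_set_scope.
Local Open Scope ring_scope.
Local Open Scope complex_scope.

(* C^n is modelled by the real normed space of pairs (x, y), read as x + iy, so
   that the real differential calculus of the library applies to it. *)
Notation Cn R n := ('rV[R]_n * 'rV[R]_n)%type.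

Section ComplexCoordinates.
Variables (R : realType) (n : nat).
Implicit Types z w : Cn R n.

Definition crd z (k : 'I_n) : R[i] := z.1 0 k +i* z.2 0 k.

Definition of_crd (f : 'I_n -> R[i]) : Cn R n :=
  (\row_k complex.Re (f k), \row_k complex.Im (f k)).

Definition mulI z : Cn R n := of_crd (fun k => (0 +i* 1) * crd z k).

(* The group (C \ 0)^n, as an open subset of C^n. *)
Definition torus : set (Cn R n) := [set z | forall k, crd z k != 0].
Definition tone : Cn R n := of_crd (fun=> 1).
Definition tmul z w : Cn R n := of_crd (fun k => crd z k * crd w k).

End ComplexCoordinates.

Section Calculus.
Variable R : realType.

(* For open U only.  In finite dimension this is C^k in the usual sense: all
   iterated directional derivatives exist and are continuous. *)
Fixpoint Ck_on (V W : normedModType R) (k : nat) (U : set V) (f : V -> W) : Prop :=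
  match k with
  | 0 => forall x, U x -> {for x, continuous f}
  | k'.+1 => (forall x, U x -> differentiable f x) /\
             (forall v, Ck_on k' U (fun x => 'd f x v))
  end.

Definition smooth_on (V W : normedModType R) (U : set V) (f : V -> W) : Prop :=
  forall k, Ck_on k U f.

(* For open U only: complex differentiability, i.e. real differentiability with
   a C-linear differential. *)
Definition holomorphic_on (m n : nat) (U : set (Cn R m)) (f : Cn R m -> Cn R n) :=
  forall z, U z ->
    differentiable f z /\ forall v, 'd f z (mulI v) = mulI ('d f z v).

End Calculus.

Section Manifolds.
Variables (R : realType) (n : nat).

Record chart (X : topologicalType) := Chart {
  dom : set X;
  to : X -> Cn R n;
  from : Cn R n -> X;
  open_dom : open dom;
  open_cod : open (to @` dom);
  toK : forall x, dom x -> from (to x) = x;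
  to_continuous : forall x, dom x -> {for x, continuous to};
  from_continuous : forall z, (to @` dom) z -> {for z, continuous from} }.

Definition cod (X : topologicalType) (c : chart X) : set (Cn R n) := to c @` dom c.

Definition smooth_transition (X : topologicalType) (c c' : chart X) : Prop :=
  smooth_on (to c @` (dom c `&` dom c')) (to c' \o from c).

Definition holomorphic_transition (X : topologicalType) (c c' : chart X) : Prop :=
  holomorphic_on (to c @` (dom c `&` dom c')) (to c' \o from c).

Definition covers (X : topologicalType) (A : set (chart X)) : Prop :=
  forall x, exists2 c, A c & dom c x.

Definition smooth_atlas (X : topologicalType) (A : set (chart X)) : Prop :=
  covers A /\ forall c c', A c -> A c' -> smooth_transition c c'.

Definition complex_atlas (X : topologicalType) (B : set (chart X)) : Prop :=
  covers B /\ forall b b', B b -> B b' -> holomorphic_transition b b'.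

(* c belongs to the maximal smooth atlas generated by A. *)
Definition smooth_chart (X : topologicalType) (A : set (chart X)) (c : chart X) :=
  forall a, A a -> smooth_transition a c /\ smooth_transition c a.

Definition holomorphic_chart (X : topologicalType) (B : set (chart X)) (c : chart X) :=
  forall b, B b -> holomorphic_transition b c /\ holomorphic_transition c b.

Definition holomorphic_map (X Y : topologicalType)
    (B : set (chart X)) (B' : set (chart Y)) (f : X -> Y) : Prop :=
  continuous f /\
  forall b b', B b -> B' b' ->
    holomorphic_on (to b @` (dom b `&` f @^-1` dom b')) (to b' \o f \o from b).

Definition biholomorphism (X Y : topologicalType)
    (B : set (chart X)) (B' : set (chart Y)) (f : X -> Y) : Prop :=
  exists g : Y -> X, [/\ cancel f g, cancel g f,
    holomorphic_map B B' f & holomorphic_map B' B g].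

(* A tangent vector at p is the family of its components in the charts of A
   around p.  The components in the other charts are fixed to 0, so that equal
   tangent vectors are equal terms. *)
Record tangent (X : topologicalType) (A : set (chart X)) (p : X) := Tangent {
  tcomp : chart X -> Cn R n;
  tcomp_change : forall c c', A c -> A c' -> dom c p -> dom c' p ->
    tcomp c' = 'd (to c' \o from c) (to c p) (tcomp c);
  tcomp_out : forall c, ~ (A c /\ dom c p) -> tcomp c = 0 }.

(* w is the image of v under the differential of f at p. *)
Definition pushforward (X : topologicalType) (A : set (chart X)) (f : X -> X)
    (p : X) (v : tangent A p) (w : tangent A (f p)) : Prop :=
  forall c c', A c -> A c' -> dom c p -> dom c' (f p) ->
    tcomp w c' = 'd (to c' \o f \o from c) (to c p) (tcomp v c).

Definition smooth_bundle_endomorphism (X : topologicalType) (A : set (chart X))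
    (J : forall p, tangent A p -> tangent A p) : Prop :=
  forall c, A c -> exists F : Cn R n -> {linear Cn R n -> Cn R n},
    (forall v, smooth_on (cod c) (fun z => F z v)) /\
    (forall p (v : tangent A p), dom c p ->
       tcomp (J p v) c = F (to c p) (tcomp v c)).

Definition almost_complex_structure (X : topologicalType) (A : set (chart X))
    (J : forall p, tangent A p -> tangent A p) : Prop :=
  smooth_bundle_endomorphism J /\
  forall p (v : tangent A p) c, tcomp (J p (J p v)) c = - tcomp v c.

Definition invariant_under (X : topologicalType) (A : set (chart X))
    (f : X -> X) (J : forall p, tangent A p -> tangent A p) : Prop :=
  forall p (v : tangent A p) (w : tangent A (f p)),
    pushforward v w -> pushforward (J p v) (J (f p) w).

(* B is a complex manifold structure on the smooth manifold (X, A), and J is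
   multiplication by i in the holomorphic coordinates of B. *)
Definition complex_structure_inducing (X : topologicalType) (A : set (chart X))
    (J : forall p, tangent A p -> tangent A p) (B : set (chart X)) : Prop :=
  [/\ complex_atlas B,
      (forall b, B b -> smooth_chart A b) &
      forall b c p (v : tangent A p), B b -> A c -> dom b p -> dom c p ->
        'd (to b \o from c) (to c p) (tcomp (J p v) c) =
        mulI ('d (to b \o from c) (to c p) (tcomp v c))].

Definition integrable_structure (X : topologicalType) (A : set (chart X))
    (J : forall p, tangent A p -> tangent A p) : Prop :=
  exists B, complex_structure_inducing J B.

End Manifolds.

Section Actions.
Variables (R : realType) (n : nat).

Definition smooth_character (chi : Cn R n -> R[i]) : Prop :=
  [/\ forall g, torus g -> chi g != 0,
      forall g h, torus g -> torus h -> chi (tmul g h) = chi g * chi h,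
      smooth_on (@torus R n) (fun g => complex.Re (chi g) : R^o) &
      smooth_on (@torus R n) (fun g => complex.Im (chi g) : R^o)].

Definition smooth_endomorphism (rho : Cn R n -> Cn R n) : Prop :=
  [/\ forall g, torus g -> torus (rho g),
      forall g h, torus g -> torus h -> rho (tmul g h) = tmul (rho g) (rho h) &
      smooth_on (@torus R n) rho].

Definition smooth_automorphism (rho : Cn R n -> Cn R n) : Prop :=
  smooth_endomorphism rho /\
  exists sigma, smooth_endomorphism sigma /\
    forall g, torus g -> sigma (rho g) = g /\ rho (sigma g) = g.

(* An action of (C \ 0)^n is a function on C^n x X, of which only the values at
   elements of the torus matter. *)
Definition torus_action (X : Type) (act : Cn R n -> X -> X) : Prop :=
  (forall x, act (tone R n) x = x) /\
  forall g h x, torus g -> torus h -> act (tmul g h) x = act g (act h x).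

Definition effective_action (X : Type) (act : Cn R n -> X -> X) : Prop :=
  forall g, torus g -> (forall x, act g x = x) -> g = tone R n.

Definition orbit_of (X : Type) (act : Cn R n -> X -> X) (x : X) : set X :=
  [set act g x | g in @torus R n].

Definition smooth_action (X : topologicalType) (A : set (chart R n X))
    (act : Cn R n -> X -> X) : Prop :=
  (forall (g : Cn R n) (x : X), torus g ->
     {for (g, x), continuous (fun q : Cn R n * X => act q.1 q.2)}) /\
  forall c c', A c -> A c' ->
    smooth_on [set q : Cn R n * Cn R n |
                 [/\ torus q.1, cod c q.2 & dom c' (act q.1 (from c q.2))]]
              (fun q => to c' (act q.1 (from c q.2))).

(* c is an equivariant diffeomorphism from an invariant open subset onto the
   direct sum of the V(chi k). *)
Definition representation_chart (X : topologicalType) (A : set (chart R n X))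
    (act : Cn R n -> X -> X) (chi : 'I_n -> Cn R n -> R[i]) (c : chart R n X) :=
  [/\ smooth_chart A c,
      cod c = setT,
      forall g x, torus g -> dom c x -> dom c (act g x) &
      forall g x k, torus g -> dom c x ->
        crd (to c (act g x)) k = chi k g * crd (to c x) k].

Definition topological_toric_manifold (X : topologicalType)
    (A : set (chart R n X)) (act : Cn R n -> X -> X) : Prop :=
  [/\ hausdorff_space X /\ compact [set: X],
      smooth_atlas A,
      [/\ torus_action act, effective_action act & smooth_action A act],
      (exists x, open (orbit_of act x) /\ dense (orbit_of act x)) &
      exists (N : nat) (c : 'I_N -> chart R n X)
             (chi : 'I_N -> 'I_n -> Cn R n -> R[i]),
        [/\ forall i k, smooth_character (chi i k),
            forall i, representation_chart A act (chi i) (c i) &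
            forall x, exists i, dom (c i) x]].

Definition invariant_almost_complex_structure (X : topologicalType)
    (A : set (chart R n X)) (act : Cn R n -> X -> X)
    (J : forall p, tangent A p -> tangent A p) : Prop :=
  almost_complex_structure J /\
  forall g, torus g -> invariant_under (act g) J.

End Actions.

Section ToricManifolds.
Variables (R : realType) (n m : nat).

(* The cones of a nonsingular fan are simplicial.  Such a fan in R^n is given by
   the primitive vectors v i of its rays and the set K of those sets of rays
   which span a cone. *)
Implicit Types (v : 'I_m -> 'rV[int]_n) (K : {set {set 'I_m}}).

Definition cone v (I : {set 'I_m}) : set 'rV[R]_n :=
  [set x | exists a : 'I_m -> R, (forall i, 0 <= a i) /\
     x = \sum_(i in I) a i *: map_mx intr (v i)].

Definition part_of_basis v (I : {set 'I_m}) : Prop :=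
  exists (P : 'M[int]_n) (r : 'I_m -> 'I_n),
    [/\ P \in unitmx, {in I &, injective r} & {in I, forall i, row (r i) P = v i}].

Definition nonsingular_complete_fan v K : Prop :=
  [/\ forall I I' : {set 'I_m}, I \in K -> I' \subset I -> I' \in K,
      forall I, I \in K -> part_of_basis v I,
      forall I I', I \in K -> I' \in K ->
        cone v I `&` cone v I' = cone v (I :&: I') &
      \bigcup_(I in [set I | I \in K]) cone v I = setT].

(* The n-dimensional cones, with an enumeration of their rays. *)
Definition rays (e : {ffun 'I_n -> 'I_m}) : {set 'I_m} := [set e k | k in 'I_n]%SET.
Definition max_cone K (e : {ffun 'I_n -> 'I_m}) : Prop :=
  injective e /\ rays e \in K.

(* The rows of ray_mx v e are the v (e k), a Z-basis of Z^n when e is a maximal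
   cone of a nonsingular fan; the dual basis of (Z^n)^* consists of the columns
   of the inverse matrix. *)
Definition ray_mx v (e : {ffun 'I_n -> 'I_m}) : 'M[int]_n := \matrix_(k, j) v (e k) 0 j.
Definition dual_mx v (e : {ffun 'I_n -> 'I_m}) : 'M[int]_n := invmx (ray_mx v e).

(* (Y, B, act) is the toric variety of the fan (v, K): it is glued from the
   affine toric varieties U_e = Spec C[e^dual \cap (Z^n)^*] = C^n of the maximal
   cones e, whose coordinates are the characters in the basis dual to e.  Two of
   them, U_e and U_e', are glued along the affine toric variety of their common
   face, where the coordinates of U_e attached to the rays not in e' do not
   vanish, and the characters are matched. *)
Definition toric_variety_of_fan (Y : topologicalType) (B : set (chart R n Y))
    (act : Cn R n -> Y -> Y) v K : Prop :=
  exists phi : {ffun 'I_n -> 'I_m} -> chart R n Y,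
  [/\ (forall e, max_cone K e -> holomorphic_chart B (phi e) /\ cod (phi e) = setT),
      (forall y, exists2 e, max_cone K e & dom (phi e) y),
      (forall e e', max_cone K e -> max_cone K e' ->
        to (phi e) @` (dom (phi e) `&` dom (phi e')) =
        [set z | forall k, e k \notin rays e' -> crd z k != 0]),
      (forall e e' y l, max_cone K e -> max_cone K e' ->
        dom (phi e) y -> dom (phi e') y ->
        crd (to (phi e') y) l =
        \prod_k crd (to (phi e) y) k ^ ((ray_mx v e *m dual_mx v e') k l)) &
      (forall e g y, max_cone K e -> torus g -> dom (phi e) y ->
        dom (phi e) (act g y) /\
        forall l, crd (to (phi e) (act g y)) l =
                  (\prod_j crd g j ^ (dual_mx v e j l)) * crd (to (phi e) y) l)].

End ToricManifolds.

Definition toric_manifold (R : realType) (n : nat) (Y : topologicalType)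
    (B : set (chart R n Y)) (act : Cn R n -> Y -> Y) : Prop :=
  [/\ hausdorff_space Y, compact [set: Y], complex_atlas B &
      exists (m : nat) (v : 'I_m -> 'rV[int]_n) (K : {set {set 'I_m}}),
        nonsingular_complete_fan R v K /\ toric_variety_of_fan B act v K].

(* Main.v *)
(* An equivariant chart carries the open dense orbit onto (C \ 0)^n, so the
   characters of the chart form a bijective homomorphism psi of the torus.
   Read in the chart, J is equivariant under all of (C \ 0)^n; shrinking
   towards the origin by real scalars shows that J is constant, equal to its
   value at the origin, which commutes with the torus and hence is diagonal
   with entries i and -i.  Conjugating the coordinates of the second kind gives
   holomorphic coordinates, so J is integrable.  A change of these coordinates,
   restricted to the orbit, is a holomorphic automorphism of (C \ 0)^n, that is,
   a Laurent monomial map with a matrix in GL_n(Z).  Once the action is twisted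
   by the inverse rho^-1 of the homomorphism rho = psi of one chosen chart, all
   charts of X become equivariant for monomial characters, and X itself is the
   toric variety: the rays of its fan are the rows of the inverse matrices.
   Limits of the curves s |-> exp(-s x) x0 turn the Hausdorff property into the
   separation of the cones and compactness into the completeness of the fan. *)

(* Three obstacles shape the proof. The characters of a chart are merely smooth, so nothing about a
   single [psi] is algebraic, and those of different charts look unrelated. They become comparable
   because all corrected charts are holomorphic for the same [J]: psi' composed with the inverse of
   psi has a complex linear differential at 1, hence is monomial, and one twist serves every chart.

   The charts come without any description of their overlaps, which a toric variety prescribes
   exactly. An overlap is as large as prescribed by uniqueness of limits ([glue]), and no larger
   because both charts must describe alike the stabilizer of a generic point of a divisor ([face]).

   A single chart shows only that the kernel of [psi] fixes the base point; its triviality takes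
   effectiveness and all the charts together.

   The structure [B] is an arbitrary one inducing [J]. It is kept on the target, with f the
   identity, and is compared with the constructed charts through [J] alone: two charts in which [J]
   is multiplication by i always differ by a holomorphic map. *)
From HB Require Import structures.
From mathcomp Require Import all_boot all_order fingroup perm all_algebra.
From mathcomp Require Import complex ring lra.
From mathcomp Require Import all_classical all_reals all_analysis.
Require Import Defs.
Import Order.TTheory GRing.Theory Num.Theory numFieldNormedType.Exports.

Set Implicit Arguments.
Unset Strict Implicit.
Unset Printing Implicit Defensive.

Local Open Scope classical_set_scope.
Local Open Scope ring_scope.
Local Open Scope complex_scope.

(** * Coordinates on C^n *)

Section CnAlgebra.
Variables (R : realType) (n : nat).
Implicit Types z w u v : Cn R n.

Lemma crdP z w : (forall k, crd z k = crd w k) -> z = w.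
Proof.
case: z w => [z1 z2] [w1 w2] h.
by congr pair; apply/rowP => k; move: (h k); rewrite /crd /= => -[].
Qed.

Lemma crd_of (f : 'I_n -> R[i]) k : crd (of_crd f) k = f k.
Proof. by rewrite /crd /of_crd /= !mxE; case: (f k). Qed.

Lemma crdD z w k : crd (z + w) k = crd z k + crd w k.
Proof. by rewrite /crd /= !mxE. Qed.

Lemma crdN z k : crd (- z) k = - crd z k.
Proof. by rewrite /crd /= !mxE. Qed.

Lemma crdB z w k : crd (z - w) k = crd z k - crd w k.
Proof. by rewrite crdD crdN. Qed.

Lemma crd0 k : crd (0 : Cn R n) k = 0.
Proof. by rewrite /crd /= !mxE. Qed.

Lemma crdZ (a : R) z k : crd (a *: z) k = a%:C * crd z k.
Proof. by rewrite /crd /= !mxE; simpc. Qed.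

Lemma crd_sum I (r : seq I) (P : pred I) (F : I -> Cn R n) k :
  crd (\sum_(i <- r | P i) F i) k = \sum_(i <- r | P i) crd (F i) k.
Proof.
exact: (big_morph (fun z => crd z k) (fun z w => crdD z w k) (crd0 k)).
Qed.

Lemma crd1 k : crd (tone R n) k = 1. Proof. by rewrite crd_of. Qed.

Lemma crdM z w k : crd (tmul z w) k = crd z k * crd w k.
Proof. by rewrite crd_of. Qed.

Lemma crdI z k : crd (mulI z) k = 'i * crd z k.
Proof. by rewrite crd_of. Qed.

Definition tinv z : Cn R n := of_crd (fun k => (crd z k)^-1).

Lemma crdV z k : crd (tinv z) k = (crd z k)^-1.
Proof. by rewrite crd_of. Qed.

Definition crdE := (crd_of, crdD, crdN, crd0, crdZ, crd_sum, crd1, crdM, crdI, crdV).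

Lemma tmulC z w : tmul z w = tmul w z.
Proof. by apply: crdP => k; rewrite !crdE mulrC. Qed.

Lemma tmulA u z w : tmul u (tmul z w) = tmul (tmul u z) w.
Proof. by apply: crdP => k; rewrite !crdE mulrA. Qed.

Lemma tmul1 z : tmul (tone R n) z = z.
Proof. by apply: crdP => k; rewrite !crdE mul1r. Qed.

Lemma tmulr1 z : tmul z (tone R n) = z.
Proof. by rewrite tmulC tmul1. Qed.

Lemma tmulV z : torus z -> tmul (tinv z) z = tone R n.
Proof. by move=> hz; apply: crdP => k; rewrite !crdE mulVf. Qed.

Lemma tmulr0 z : tmul z 0 = 0.
Proof. by apply: crdP => k; rewrite !crdE mulr0. Qed.

Lemma torus1 : torus (tone R n).
Proof. by move=> k; rewrite crd1 oner_neq0. Qed.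

Lemma torusM z w : torus z -> torus w -> torus (tmul z w).
Proof. by move=> hz hw k; rewrite crdM mulf_neq0. Qed.

Lemma torusV z : torus z -> torus (tinv z).
Proof. by move=> hz k; rewrite crdV invr_eq0. Qed.

Lemma tmulI z u w : torus z -> tmul z u = tmul z w -> u = w.
Proof.
by move=> hz /(congr1 (tmul (tinv z))); rewrite !tmulA tmulV // !tmul1.
Qed.

Lemma tmul_is_linear z : linear (tmul z).
Proof.
move=> a u v; apply: crdP => k; rewrite !crdE mulrDr; congr (_ + _).
by rewrite mulrCA.
Qed.
HB.instance Definition _ z :=
  GRing.isLinear.Build R (Cn R n) (Cn R n) _ (tmul z) (tmul_is_linear z).

Lemma mulI_is_linear : linear (@mulI R n).
Proof.
move=> a u v; apply: crdP => k; rewrite !crdE mulrDr; congr (_ + _).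
by rewrite mulrCA.
Qed.
HB.instance Definition _ :=
  GRing.isLinear.Build R (Cn R n) (Cn R n) _ (@mulI R n) mulI_is_linear.

(** For [a] equal to 1 and to ['i] these vectors form the real basis used by [CnE], to which
    continuity and differentiability on C^n are reduced. *)
Definition unitv (a : R[i]) (k : 'I_n) : Cn R n :=
  of_crd (fun l => if l == k then a else 0).

Lemma CnE z : z = \sum_k (complex.Re (crd z k) *: unitv 1 k +
                          complex.Im (crd z k) *: unitv 'i k).
Proof.
apply: crdP => l; rewrite crd_sum (bigD1 l) //= big1 => [|k kl].
  rewrite addr0 !crdE eqxx mulr1 {1}[crd z l]complexE; congr (_ + _).
  by rewrite mulrC.
by rewrite !crdE eq_sym (negbTE kl) !mulr0 addr0.
Qed.

End CnAlgebra.

(** * Differential calculus *)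

Section Differentials.
Variables (R : realType).

(** Chart changes agree with composites of others only near a point. The differential passes along
    such local equalities because the first-order expansion determines it. *)
Lemma near_is_diff (V W : normedModType R) (f g df : V -> W) (x : V) :
  (\forall y \near x, f y = g y) -> is_diff x f df -> is_diff x g df.
Proof.
move=> fg [fx <-].
have [dc E] := (diff_locallyP x f).1 fx.
have E' : g \o shift x = cst (g x) + 'd f x +o_ 0 id.
  apply/eqaddoP => _/posnumP[e]; move/eqaddoP: E => /(_ e%:num (gt0 _)) E.
  move: fg; rewrite (near_shift 0) /= subr0 => fg.
  near=> h.
  have h1 : f (h + x) = g (h + x) by near: h.
  have h2 : f x = g x by move: (nbhs_singleton fg); rewrite /= add0r.
  by rewrite !fctE /= -h1 -h2; near: h; exact: E.
have D := diff_unique dc E'.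
have dg : differentiable g x by apply/diff_locallyP; rewrite D; split.
exact: (@DiffDef _ _ _ _ _ _ _ dg D).
Unshelve. all: by end_near. Qed.

Lemma cvg_sumr (V : normedModType R) (T : Type) (F : set_system T) (FF : Filter F)
    I (r : seq I) (f : I -> T -> V) (a : I -> V) :
  (forall i, f i @ F --> a i) ->
  (fun t => \sum_(i <- r) f i t) @ F --> \sum_(i <- r) a i.
Proof.
move=> fa; elim: r => [|i r IH].
  by rewrite big_nil; under eq_cvg do rewrite big_nil; exact: cvg_cst.
rewrite big_cons; under eq_cvg do rewrite big_cons.
exact: (cvgD (fa i) IH).
Qed.

Lemma cvg_Cn n (T : Type) (F : set_system T) (FF : Filter F) (f : T -> Cn R n) z :
  (forall k, complex.Re (crd (f t) k) @[t --> F] --> complex.Re (crd z k)) ->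
  (forall k, complex.Im (crd (f t) k) @[t --> F] --> complex.Im (crd z k)) ->
  f @ F --> z.
Proof.
move=> hr hi; rewrite [z]CnE.
rewrite (_ : f = fun t => \sum_k (complex.Re (crd (f t) k) *: unitv 1 k +
                          complex.Im (crd (f t) k) *: unitv 'i k)); last first.
  by apply/funext => t; rewrite -CnE.
apply: cvg_sumr => k.
by apply: cvgD; apply: cvgZr_tmp; [exact: hr|exact: hi].
Qed.

Lemma continuous_Re n k : continuous (fun z : Cn R n => complex.Re (crd z k)).
Proof.
move=> z; apply: (@continuous_comp _ _ _ fst (fun v : 'rV_n => v 0 k)).
  exact: cvg_fst.
exact: coord_continuous.
Qed.

Lemma continuous_Im n k : continuous (fun z : Cn R n => complex.Im (crd z k)).
Proof.
move=> z; apply: (@continuous_comp _ _ _ snd (fun v : 'rV_n => v 0 k)).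
  exact: cvg_snd.
exact: coord_continuous.
Qed.

Lemma linear_Cn_continuous n (W : normedModType R) (f : {linear Cn R n -> W}) :
  continuous f.
Proof.
move=> z.
have fE w : f w = \sum_k (complex.Re (crd w k) *: f (unitv 1 k) +
                          complex.Im (crd w k) *: f (unitv 'i k)).
  by rewrite {1}[w]CnE linear_sum; apply: eq_bigr => k _; rewrite linearD !linearZ.
pose g k w := complex.Re (crd w k) *: f (unitv 1 k) +
              complex.Im (crd w k) *: f (unitv 'i k).
suff H : (fun w => \sum_k g k w) @ z --> \sum_k g k z.
  by move: H; rewrite -fE; under eq_cvg do rewrite -fE.
apply: cvg_sumr => k.
by apply: cvgD; apply: cvgZr_tmp; [exact: continuous_Re|exact: continuous_Im].
Qed.

Lemma linear_Cn_is_diff n (W : normedModType R) (f : {linear Cn R n -> W}) z :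
  is_diff z f f.
Proof.
split; first exact: linear_differentiable (@linear_Cn_continuous _ _ _).
by rewrite diff_lin //; exact: linear_Cn_continuous.
Qed.

Lemma is_diff_Cn n (V : normedModType R) (f df : V -> Cn R n) x :
  (forall k, is_diff x (fun t => complex.Re (crd (f t) k)) 
                       (fun t => complex.Re (crd (df t) k))) ->
  (forall k, is_diff x (fun t => complex.Im (crd (f t) k)) 
                       (fun t => complex.Im (crd (df t) k))) ->
  is_diff x f df.
Proof.
move=> hr hi.
pose g := \sum_k ((fun t => complex.Re (crd (f t) k) *: unitv 1 k) +
                  (fun t => complex.Im (crd (f t) k) *: unitv 'i k)).
pose dg := \sum_k ((fun t => complex.Re (crd (df t) k) *: unitv 1 k) +
                  (fun t => complex.Im (crd (df t) k) *: unitv 'i k)).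
have -> : f = g.
  by apply/funext => t; rewrite [LHS]CnE /g fct_sumE; apply: eq_bigr.
have -> : df = dg.
  by apply/funext => t; rewrite [LHS]CnE /dg fct_sumE; apply: eq_bigr.
rewrite /g /dg.
elim/big_ind2: _ => [|? ? ? ? ? ?|k _]; first exact: is_diff_cst.
  exact: is_diffD.
apply: is_diffD.
  have := @is_diff_comp _ _ _ _ _ _ _ _ x (hr k) (is_diff_scalel _ (unitv 1 k)).
  exact.
have := @is_diff_comp _ _ _ _ _ _ _ _ x (hi k) (is_diff_scalel _ (unitv 'i k)).
exact.
Qed.
End Differentials.

Section DiffCn.
Variables (R : realType) (n : nat).

Lemma Re_crd_linear k : linear (fun z : Cn R n => complex.Re (crd z k)).
Proof. by move=> a u v; rewrite !crdE /=; case: (crd u k) => x y; case: (crd v k) => x' y' /=;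
    rewrite mul0r subr0. Qed.

Lemma Im_crd_linear k : linear (fun z : Cn R n => complex.Im (crd z k)).
Proof. by move=> a u v; rewrite !crdE /=; case: (crd u k) => x y; case: (crd v k) => x' y' /=;
    rewrite mul0r addr0. Qed.

Lemma is_diff_lin (V W : normedModType R) m (f df : V -> Cn R m) (L : Cn R m -> W) x :
  linear L -> is_diff x f df -> is_diff x (L \o f) (L \o df).
Proof.
move=> lL fx; pose aL := GRing.isLinear.Build _ _ _ _ _ lL.
pose LL : {linear _ -> _} := HB.pack L aL.
exact: (is_diff_comp fx (linear_Cn_is_diff LL (f x))).
Qed.

Lemma is_diff_Re (V : normedModType R) (f df : V -> Cn R n) x k :
  is_diff x f df ->
  is_diff x (fun t => complex.Re (crd (f t) k)) (fun t => complex.Re (crd (df t) k)).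
Proof. exact: is_diff_lin (Re_crd_linear k). Qed.

Lemma is_diff_Im (V : normedModType R) (f df : V -> Cn R n) x k :
  is_diff x f df ->
  is_diff x (fun t => complex.Im (crd (f t) k)) (fun t => complex.Im (crd (df t) k)).
Proof. exact: is_diff_lin (Im_crd_linear k). Qed.

Lemma differentiable_Cn (V : normedModType R) (f : V -> Cn R n) x :
  (forall k, differentiable (fun t => complex.Re (crd (f t) k)) x) ->
  (forall k, differentiable (fun t => complex.Im (crd (f t) k)) x) ->
  differentiable f x.
Proof.
move=> hr hi.
pose df v : Cn R n := of_crd (fun k => 'd (fun t => complex.Re (crd (f t) k)) x v +i*
                            'd (fun t => complex.Im (crd (f t) k)) x v).
suff [] : is_diff x f df by [].
apply: is_diff_Cn => k; under [X in is_diff_def _ _ X]eq_fun do rewrite /df crd_of /=.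
  exact: differentiableP.
exact: differentiableP.
Qed.

Lemma is_diff_tmul (V : normedModType R) (f df g dg : V -> Cn R n) x :
  is_diff x f df -> is_diff x g dg ->
  is_diff x (fun t => tmul (f t) (g t)) (fun v => tmul (f x) (dg v) + tmul (df v) (g x)).
Proof.
move=> fx gx; apply: is_diff_Cn => k.
  have h := is_diffB (is_diffM (is_diff_Re k fx) (is_diff_Re k gx))
              (is_diffM (is_diff_Im k fx) (is_diff_Im k gx)).
  rewrite (_ : (fun t => _) = (fun t => complex.Re (crd (f t) k)) * (fun t =>
      complex.Re (crd (g t) k))
     - (fun t => complex.Im (crd (f t) k)) * (fun t => complex.Im (crd (g t) k))); last first.
    by apply/funext => t; rewrite !fctE !crdE; case: (crd (f t) k) => a b; case: (crd (g t) k)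
        => c d.
  apply: is_diff_eq h _; apply/funext => v; rewrite !fctE !crdE.
  case: (crd (f x) k) => a b; case: (crd (g x) k) => c d.
  case: (crd (df v) k) => a' b'; case: (crd (dg v) k) => c' d' /=.
  by rewrite /GRing.scale /= (mulrC c) (mulrC d) opprD addrACA.
have h := is_diffD (is_diffM (is_diff_Re k fx) (is_diff_Im k gx))
              (is_diffM (is_diff_Im k fx) (is_diff_Re k gx)).
rewrite (_ : (fun t => _) = (fun t => complex.Re (crd (f t) k)) * (fun t =>
    complex.Im (crd (g t) k))
     + (fun t => complex.Im (crd (f t) k)) * (fun t => complex.Re (crd (g t) k))); last first.
  by apply/funext => t; rewrite !fctE !crdE; case: (crd (f t) k) => a b; case: (crd (g t) k) =>
      c d.
apply: is_diff_eq h _; apply/funext => v; rewrite !fctE !crdE.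
case: (crd (f x) k) => a b; case: (crd (g x) k) => c d.
case: (crd (df v) k) => a' b'; case: (crd (dg v) k) => c' d' /=.
rewrite /GRing.scale /= (mulrC c) (mulrC d) -!addrA; congr (_ + _).
by rewrite addrC -!addrA; congr (_ + _); rewrite addrC.
Qed.

Lemma open_torus : open (@torus R n).
Proof.
rewrite openE => z hz.
suff : \forall w \near z, forall k, crd w k != 0 by [].
apply: (@filter_forall _ _ (fun k w => crd w k != 0) (nbhs z)) => k.
have /orP[h|h] : (complex.Re (crd z k) != 0) || (complex.Im (crd z k) != 0).
  by move: (hz k); rewrite eq_complex negb_and.
- apply: filterS (cvgr_neq0 _ (@continuous_Re R n k z) h) => w.
  by apply: contra => /eqP->.
- apply: filterS (cvgr_neq0 _ (@continuous_Im R n k z) h) => w.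
  by apply: contra => /eqP->.
Qed.

End DiffCn.

(** * Stability of the classes C^k *)

Section CkCalculus.
Variables (R : realType).
Implicit Types V W : normedModType R.

Lemma open_near V (U : set V) (P : V -> Prop) z :
  open U -> U z -> (forall w, U w -> P w) -> \forall w \near z, P w.
Proof. by move=> oU Uz h; apply: filterS (open_nbhs_nbhs (conj oU Uz)). Qed.

Lemma Ck_ext V W k (U : set V) (f g : V -> W) : open U ->
  (forall x, U x -> f x = g x) -> Ck_on k U f -> Ck_on k U g.
Proof.
move=> oU; elim: k f g => [|k IH] f g fg /=.
  move=> fc x Ux; suff H : g @ x --> f x by move: H; rewrite (fg x Ux).
  apply: cvg_trans (fc x Ux); apply: near_eq_cvg.
  exact: open_near oU Ux fg.
move=> [df Cf].
have D x : U x -> is_diff x g ('d f x).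
  move=> Ux; apply: near_is_diff (differentiableP (df x Ux)).
  exact: open_near oU Ux fg.
split=> [x /D[]//|v]; apply: IH (Cf v) => x /D[_ ->]//.
Qed.

Lemma CkS V W k (U : set V) (f : V -> W) : Ck_on k.+1 U f -> Ck_on k U f.
Proof.
elim: k f => [|k IH] f [df Cf].
  by move=> x Ux; exact: differentiable_continuous (df x Ux).
by split=> // v; exact: IH (Cf v).
Qed.

Lemma Ck_sub V W k (U U' : set V) (f : V -> W) : U' `<=` U ->
  Ck_on k U f -> Ck_on k U' f.
Proof.
move=> sU; elim: k f => [|k IH] f /=; first by move=> h x /sU; exact: h.
by move=> [df Cf]; split => [x /sU|v]; [exact: df|exact: IH].
Qed.

Lemma Ck_add V W k (U : set V) (f g : V -> W) : open U ->
  Ck_on k U f -> Ck_on k U g -> Ck_on k U (fun x => f x + g x).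
Proof.
move=> oU; elim: k f g => [|k IH] f g /=.
  by move=> cf cg x Ux; apply: cvgD; [exact: cf|exact: cg].
move=> [df Cf] [dg Cg].
have D x : U x -> is_diff x (fun t => f t + g t) (fun v => 'd f x v + 'd g x v).
  by move=> Ux; exact: (is_diffD (differentiableP (df x Ux)) (differentiableP (dg x Ux))).
split=> [x /D[]//|v]; apply: Ck_ext oU _ (IH _ _ (Cf v) (Cg v)) => x /D[_ E];
exact: (esym (congr1 (fun F => F v) E)).
Qed.

Lemma Ck_linear_l V W n k (U : set V) (f : V -> Cn R n) (L : Cn R n -> W) :
  linear L -> open U -> Ck_on k U f -> Ck_on k U (fun x => L (f x)).
Proof.
move=> lL oU; elim: k f => [|k IH] f /=.
  move=> cf x Ux; apply: (@continuous_comp _ _ _ f L x (cf x Ux)).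
  pose aL := GRing.isLinear.Build _ _ _ _ _ lL.
  by pose LL : {linear _ -> _} := HB.pack L aL; exact: (@linear_Cn_continuous _ _ _ LL).
move=> [df Cf].
have D x : U x -> is_diff x (fun t => L (f t)) (L \o 'd f x).
  by move=> Ux; apply: is_diff_lin lL (differentiableP (df x Ux)).
split=> [x /D[]//|v]; apply: Ck_ext oU _ (IH _ (Cf v)) => x /D[_ E];
exact: (esym (congr1 (fun F => F v) E)).
Qed.

Lemma Ck_linear_r m n W k (U : set (Cn R n)) (f : Cn R n -> W) (L : {linear Cn R m -> Cn R n}) :
  open U -> Ck_on k U f -> Ck_on k (L @^-1` U) (fun x => f (L x)).
Proof.
move=> oU; have cL := @linear_Cn_continuous _ _ _ L.
have oLU : open (L @^-1` U) by apply: open_comp => // x _; exact: cL.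
elim: k f => [|k IH] f /=.
  move=> cf x Ux; apply: (@continuous_comp _ _ _ L f x (cL x)); exact: cf.
move=> [df Cf].
have D x : U (L x) -> is_diff x (fun t => f (L t)) ('d f (L x) \o L).
  move=> Ux; exact: (is_diff_comp (linear_Cn_is_diff L x) (differentiableP (df _ Ux))).
split=> [x /D[]//|v]; apply: Ck_ext oLU _ (IH _ (Cf (L v))) => x /D[_ E];
exact: (esym (congr1 (fun F => F v) E)).
Qed.

(** By the Leibniz rule the derivative involves [f] and [g] themselves, so the induction uses [CkS]
    to lower their class. *)
Lemma Ck_tmul V n k (U : set V) (f g : V -> Cn R n) : open U ->
  Ck_on k U f -> Ck_on k U g -> Ck_on k U (fun x => tmul (f x) (g x)).
Proof.
move=> oU; elim: k f g => [|k IH] f g /=.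
  move=> cf cg x Ux.
  have cR (h : V -> Cn R n) j : {for x, continuous h} ->
      complex.Re (crd (h y) j) @[y --> x] --> complex.Re (crd (h x) j).
    move=> ch; exact: (@continuous_comp _ _ _ h (fun z => complex.Re (crd z j))
        x ch (@continuous_Re _ _ _ _)).
  have cI (h : V -> Cn R n) j : {for x, continuous h} ->
      complex.Im (crd (h y) j) @[y --> x] --> complex.Im (crd (h x) j).
    move=> ch; exact: (@continuous_comp _ _ _ h (fun z => complex.Im (crd z j))
        x ch (@continuous_Im _ _ _ _)).
  have ReM y j : complex.Re (crd (tmul (f y) (g y)) j) =
    complex.Re (crd (f y) j) * complex.Re (crd (g y) j) - complex.Im (crd (f y) j)
        * complex.Im (crd (g y) j).
    by rewrite !crdE; case: (crd (f y) j) => a b; case: (crd (g y) j).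
  have ImM y j : complex.Im (crd (tmul (f y) (g y)) j) =
    complex.Re (crd (f y) j) * complex.Im (crd (g y) j) + complex.Im (crd (f y) j)
        * complex.Re (crd (g y) j).
    by rewrite !crdE; case: (crd (f y) j) => a b; case: (crd (g y) j).
  have {}cf := cf x Ux; have {}cg := cg x Ux.
  apply: cvg_Cn => j.
    rewrite ReM; under eq_cvg do rewrite ReM.
    by apply: cvgB; apply: cvgM; [exact: cR|exact: cR|exact: cI|exact: cI].
  rewrite ImM; under eq_cvg do rewrite ImM.
  by apply: cvgD; apply: cvgM; [exact: cR|exact: cI|exact: cI|exact: cR].
move=> Cf Cg; have [df Cdf] := Cf; have [dg Cdg] := Cg.
have D x : U x -> is_diff x (fun t => tmul (f t) (g t))
    (fun v => tmul (f x) ('d g x v) + tmul ('d f x v) (g x)).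
  by move=> Ux; apply: is_diff_tmul; apply: differentiableP; [exact: df|exact: dg].
split=> [x /D[]//|v].
apply: Ck_ext oU _ (Ck_add oU (IH _ _ (CkS Cf) (Cdg v)) (IH _ _ (Cdf v) (CkS Cg))).
by move=> x /D[_ E]; exact: (esym (congr1 (fun F => F v) E)).
Qed.

End CkCalculus.

(** * Homomorphisms of the torus *)

Section ComplexExponential.
Variable R : realType.
Implicit Types a b z : R[i].

Definition cexp1 a : R[i] :=
  (expR (complex.Re a) * cos (complex.Im a)) +i* (expR (complex.Re a) * sin (complex.Im a)).

Lemma cexp1D a b : cexp1 (a + b) = cexp1 a * cexp1 b.
Proof.
case: a b => [x y] [x' y']; rewrite /cexp1 /= expRD cosD sinD; simpc.
by congr (_ +i* _); ring.
Qed.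

Lemma cexp10 : cexp1 0 = 1.
Proof. by rewrite /cexp1 /= expR0 cos0 sin0 mulr0 mulr1. Qed.

Lemma cexp1_neq0 a : cexp1 a != 0.
Proof.
apply/eqP => h; have := cexp1D a (- a); rewrite h mul0r subrr cexp10.
by move/eqP; rewrite oner_eq0.
Qed.

Lemma cexp1N a : cexp1 (- a) = (cexp1 a)^-1.
Proof.
apply: (mulfI (cexp1_neq0 a)); rewrite -cexp1D subrr cexp10.
by rewrite divff // cexp1_neq0.
Qed.

Lemma cexp1_nat a m : cexp1 (m%:R * a) = cexp1 a ^+ m.
Proof.
elim: m => [|m IH]; first by rewrite mul0r cexp10 expr0.
by rewrite -natr1 mulrDl mul1r cexp1D IH exprSr.
Qed.

Lemma cexp1_int a (m : int) : cexp1 (m%:~R * a) = cexp1 a ^ m.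
Proof.
case: m => m; first exact: cexp1_nat.
rewrite NegzE mulrNz mulNr cexp1N; congr (_^-1); exact: cexp1_nat.
Qed.

Lemma cexp1_sum I (r : seq I) (F : I -> R[i]) :
  cexp1 (\sum_(i <- r) F i) = \prod_(i <- r) cexp1 (F i).
Proof. exact: (big_morph cexp1 cexp1D cexp10). Qed.

(** [acos] reaches only the upper half circle; the sign of [y] decides between [acos x] and its
    opposite. *)
Lemma polar (x y : R) : x ^+ 2 + y ^+ 2 = 1 -> exists t, x = cos t /\ y = sin t.
Proof.
move=> h.
have x1 : -1 <= x <= 1.
  rewrite -ler_norml -(@ler_pXn2r _ 2) ?nnegrE // expr1n real_normK ?num_real //.
  by rewrite -h lerDl sqr_ge0.
have s1 : sin (acos x) = `|y|.
  by rewrite sin_acos // -h addrC addKr sqrtr_sqr.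
have [y0|y0] := leP 0 y.
  by exists (acos x); rewrite acosK ?in_itv // s1 ger0_norm.
exists (- acos x); rewrite cosN sinN acosK ?in_itv // s1 ltr0_norm //.
by rewrite opprK.
Qed.

Lemma cexp1_surj z : z != 0 -> exists a, cexp1 a = z.
Proof.
case: z => x y z0.
have r0 : 0 < x ^+ 2 + y ^+ 2.
  rewrite lt_neqAle addr_ge0 ?sqr_ge0 // andbT eq_sym paddr_eq0 ?sqr_ge0 //.
  by rewrite !sqrf_eq0; move: z0; rewrite eq_complex.
pose r := Num.sqrt (x ^+ 2 + y ^+ 2).
have rp : 0 < r by rewrite sqrtr_gt0.
have rr : r ^+ 2 = x ^+ 2 + y ^+ 2 by rewrite sqr_sqrtr // ltW.
have [|t [hx hy]] := @polar (x / r) (y / r).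
  by rewrite !expr_div_n -mulrDl rr divff // gt_eqF.
exists (ln r +i* t); rewrite /cexp1 /= lnK ?posrE // -hx -hy.
by congr (_ +i* _); rewrite mulrC divfK ?gt_eqF.
Qed.

(** Reduce [x] modulo 2 pi to some [y] in [0, 2 pi). The double-angle formula then forces sin (y /
    2) = 0, while sin is positive on (0, pi). *)
Lemma cos_eq1 (x : R) : cos x = 1 -> exists m : int, x = pi *+ 2 * m%:~R.
Proof.
move=> h; pose m := Num.floor (x / (pi *+ 2)); exists m.
have p2 : 0 < pi *+ 2 :> R by rewrite pmulrn_lgt0 // pi_gt0.
have cosZ (k : int) (y : R) : cos (y + (pi *+ 2) * k%:~R) = cos y.
  have cosn (j : nat) (w : R) : cos (w + (pi *+ 2) * j%:R) = cos w.
    by rewrite mulr_natr (periodicn (@cosD2pi R)).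
  case: k => j; first exact: cosn.
  rewrite NegzE mulrNz -[LHS](cosn j.+1).
  by rewrite mulrN addrNK.
pose y := x - pi *+ 2 * m%:~R.
have cy : cos y = 1 by rewrite -(cosZ m) /y subrK.
have y0 : 0 <= y.
  by rewrite subr_ge0 mulrC -ler_pdivlMr // ge_floor.
have y2 : y < pi *+ 2.
  rewrite ltrBlDr -[X in _ < X + _]mulr1 -mulrDr [X in _ < X]mulrC -ltr_pdivrMr // addrC.
  by have := lt_succ_floor (x / (pi *+ 2)); rewrite intrD.
apply/eqP; rewrite -subr_eq0 -/y; apply/negPn/negP => yn0.
have : 0 < sin (y / 2).
  apply: sin_gt0_pi; apply/andP; split; last by rewrite ltr_pdivrMr // mulr_natr.
  by rewrite divr_gt0 // lt_neqAle eq_sym yn0.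
have := cos_mulr2n (y / 2); rewrite -[y / 2 *+ 2]mulr_natr divfK // cy.
have := cos2Dsin2 (y / 2).
move=> h1 h2 h3; have : sin (y / 2) ^+ 2 = 0 by lra.
by move/eqP; rewrite sqrf_eq0 => /eqP h4; rewrite h4 ltxx in h3.
Qed.

Lemma cexp1_eq1 a : cexp1 a = 1 ->
  exists m : int, a = 0 +i* (pi *+ 2 * m%:~R).
Proof.
case: a => x y; rewrite /cexp1 /= => -[hc hs].
have x0 : expR x = 1.
  have : (expR x) ^+ 2 = 1.
    have : (expR x * cos y) ^+ 2 + (expR x * sin y) ^+ 2 = 1.
      by rewrite hc hs expr1n expr0n addr0.
    by rewrite !exprMn -mulrDr cos2Dsin2 mulr1.
  move/eqP; rewrite sqrf_eq1 => /orP[/eqP//|/eqP h].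
  by have := expR_gt0 x; rewrite h oppr_gt0 ltr10.
have [m ->] : exists m : int, y = pi *+ 2 * m%:~R.
  by apply: cos_eq1; move: hc; rewrite x0 mul1r.
by exists m; congr (_ +i* _); apply: expR_inj; rewrite x0 expR0.
Qed.

Lemma cexp1_2pi : cexp1 (0 +i* (pi *+ 2)) = 1.
Proof. by rewrite /cexp1 /= expR0 cos2pi sin2pi mulr0 mulr1. Qed.

(** The product of p + iq with exp (- t (a + ib)) has derivative zero, hence is constant; [dP] and
    [dQ] treat its real and imaginary parts. *)
Lemma linear_ode (p q : R -> R) (a b : R) :
  (forall s, is_derive (s : R) (1 : R) p (a * p s - b * q s)) ->
  (forall s, is_derive (s : R) (1 : R) q (b * p s + a * q s)) ->
  p 0 = 1 -> q 0 = 0 ->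
  forall s, p s +i* q s = cexp1 (s%:C * (a +i* b)).
Proof.
move=> dp dq p0 q0 s.
pose C (t : R) : R := cos (b * t); pose S (t : R) : R := sin (b * t); pose E (t : R) : R :=
    expR (- a * t).
have dlin (c : R) t : is_derive (t : R) (1 : R) (fun t => c * t) c.
  have h := is_deriveZ c (is_derive_id t (1 : R)).
  by apply: is_derive_eq h _; rewrite /GRing.scale /= mulr1.
have dC t : is_derive (t : R) (1 : R) C (- S t * b).
  exact: (is_derive1_comp (is_derive_cos (b * t)) (dlin b t)).
have dS t : is_derive (t : R) (1 : R) S (C t * b).
  exact: (is_derive1_comp (is_derive_sin (b * t)) (dlin b t)).
have dE t : is_derive (t : R) (1 : R) E (E t * - a).
  exact: (is_derive1_comp (is_derive_expR (- a * t)) (dlin (- a) t)).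
have dP t : is_derive (t : R) (1 : R) ((p * C + q * S) * E) 0.
  apply: is_derive_eq (is_deriveM (is_deriveD (is_deriveM (dp t) (dC t))
    (is_deriveM (dq t) (dS t))) (dE t)) _.
  by rewrite !fctE /GRing.scale /=; ring.
have dQ t : is_derive (t : R) (1 : R) ((q * C - p * S) * E) 0.
  apply: is_derive_eq (is_deriveM (is_deriveB (is_deriveM (dq t) (dC t))
    (is_deriveM (dp t) (dS t))) (dE t)) _.
  by rewrite !fctE /GRing.scale /=; ring.
have := is_derive_0_is_cst s 0 dP; have := is_derive_0_is_cst s 0 dQ.
rewrite !fctE /C /S /E !mulr0 cos0 sin0 expR0 p0 q0 !mulr0 !mulr1 subr0 addr0.
rewrite mulNr expRN => hQ hP.
have e0 : expR (a * s) != 0 by rewrite gt_eqF // expR_gt0.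
have {}hQ : q s * cos (b * s) - p s * sin (b * s) = 0.
  by apply/eqP; have := hQ => /eqP; rewrite mulf_eq0 invr_eq0 (negbTE e0) orbF.
have {}hP : p s * cos (b * s) + q s * sin (b * s) = expR (a * s).
  by rewrite -[LHS](divfK e0) hP mul1r.
have cs := cos2Dsin2 (b * s).
rewrite /cexp1 /= mul0r subr0 mul0r addr0 ![s * _]mulrC.
congr (_ +i* _).
  (* The rotation by [b * s] is undone, using cos^2 + sin^2 = 1. *)
  rewrite -hP -[LHS]mulr1 -cs.
  transitivity ((p s * cos (b * s) + q s * sin (b * s)) * cos (b * s)
    - (q s * cos (b * s) - p s * sin (b * s)) * sin (b * s)); first by ring.
  by rewrite hQ; ring.
rewrite -hP -[LHS]mulr1 -cs.
transitivity ((p s * cos (b * s) + q s * sin (b * s)) * sin (b * s)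
    + (q s * cos (b * s) - p s * sin (b * s)) * cos (b * s)); first by ring.
by rewrite hQ; ring.
Qed.

End ComplexExponential.

Section TorusExponential.
Variables (R : realType) (n : nat).
Implicit Types u v z : Cn R n.

Definition cexp u : Cn R n := of_crd (fun k => cexp1 (crd u k)).

Lemma cexpE u k : crd (cexp u) k = cexp1 (crd u k).
Proof. by rewrite crd_of. Qed.

Lemma torus_cexp u : torus (cexp u).
Proof. by move=> k; rewrite cexpE cexp1_neq0. Qed.

Lemma cexpD u v : cexp (u + v) = tmul (cexp u) (cexp v).
Proof. by apply: crdP => k; rewrite crdM !cexpE crdD cexp1D. Qed.

Lemma cexp0 : cexp 0 = tone R n.
Proof. by apply: crdP => k; rewrite crd1 cexpE crd0 cexp10. Qed.

Lemma cexp_surj z : torus z -> exists u, cexp u = z.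
Proof.
move=> hz; have /choice[f hf] : forall k, exists a, cexp1 a = crd z k.
  by move=> k; apply: cexp1_surj.
by exists (of_crd f); apply: crdP => k; rewrite cexpE crd_of hf.
Qed.

Lemma is_diff1 (f : R -> R) (x a : R) :
  is_derive x (1 : R) f a -> is_diff x f (fun t => t * a).
Proof.
move=> h; have fx : differentiable f x by apply/derivable1_diffP; apply: ex_derive.
apply: DiffDef => //; apply/funext => t.
rewrite -[t in LHS]mulr1 -[t * 1]/(t *: 1) linearZ /= -deriveE //.
by rewrite derive_val.
Qed.

Lemma is_diff_derive (V W : normedModType R) (f df : V -> W) (x v : V) :
  is_diff x f df -> is_derive x v f (df v).
Proof.
case=> fx E; apply: DeriveDef; first exact: diff_derivable.
by rewrite deriveE // E.
Qed.

Lemma differentiable_cexp u : differentiable cexp u.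
Proof.
have dR k := is_diff_Re k (is_diff_id u).
have dI k := is_diff_Im k (is_diff_id u).
have dE k : differentiable (fun w : Cn R n => expR (complex.Re (crd w k))) u.
  have [h _] := dR k; apply: (differentiable_comp h).
  have [] := is_diff1 (is_derive_expR (complex.Re (crd u k))); exact.
have dC k : differentiable (fun w : Cn R n => cos (complex.Im (crd w k))) u.
  have [h _] := dI k; apply: (differentiable_comp h).
  have [] := is_diff1 (is_derive_cos (complex.Im (crd u k))); exact.
have dS k : differentiable (fun w : Cn R n => sin (complex.Im (crd w k))) u.
  have [h _] := dI k; apply: (differentiable_comp h).
  have [] := is_diff1 (is_derive_sin (complex.Im (crd u k))); exact.
apply: differentiable_Cn => k.
  have := differentiableM (dE k) (dC k).
  congr (differentiable _ _); apply/funext => w.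
  by rewrite !fctE cexpE.
have := differentiableM (dE k) (dS k).
congr (differentiable _ _); apply/funext => w.
by rewrite !fctE cexpE.
Qed.

(** Time 0 suffices: homomorphisms carry the derivative to all other times by translation. *)
Lemma is_diff_cexp_line u : is_diff (0 : R) (fun t : R => cexp (t *: u)) (fun t => t *: u).
Proof.
have dl (c t : R) : is_derive (t : R) (1 : R) (fun t => t * c) c.
  have h := is_deriveZ c (is_derive_id t (1 : R)).
  have -> : (fun t => t * c) = c *: id by apply/funext => x; rewrite !fctE mulrC.
  by apply: is_derive_eq h _; rewrite /GRing.scale /= mulr1.
apply: is_diff_Cn => k; case E : (crd u k) => [a b].
  have h := is_diff1 (is_deriveM (@is_derive1_comp R expR (fun t => t * a)
      0 _ _ (is_derive_expR (0 * a)) (dl a 0))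
     (@is_derive1_comp R cos (fun t => t * b) 0 _ _ (is_derive_cos (0 * b)) (dl b 0))).
  rewrite (_ : (fun t => _) = (expR \o *%R^~ a) * (cos \o *%R^~ b)); last first.
    by apply/funext => t; rewrite cexpE crdZ E !fctE /=; congr (expR _ * cos _); ring.
  apply: is_diff_eq h _; apply/funext => t.
  by rewrite crdZ E /= /GRing.scale /= !mul0r cos0 sin0 expR0; ring.
have h := is_diff1 (is_deriveM (@is_derive1_comp R expR (fun t => t * a)
    0 _ _ (is_derive_expR (0 * a)) (dl a 0))
     (@is_derive1_comp R sin (fun t => t * b) 0 _ _ (is_derive_sin (0 * b)) (dl b 0))).
rewrite (_ : (fun t => _) = (expR \o *%R^~ a) * (sin \o *%R^~ b)); last first.
  by apply/funext => t; rewrite cexpE crdZ E !fctE /=; congr (expR _ * sin _); ring.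
apply: is_diff_eq h _; apply/funext => t.
by rewrite crdZ E /= /GRing.scale /= !mul0r cos0 sin0 expR0; ring.
Qed.

End TorusExponential.

Section TorusHomomorphisms.
Variables (R : realType) (n : nat).
Implicit Types u v z g : Cn R n.
Local Notation "1T" := (tone R n).

Definition torus_hom (h : Cn R n -> Cn R n) : Prop :=
  (forall g, torus g -> torus (h g)) /\
  (forall g g', torus g -> torus g' -> h (tmul g g') = tmul (h g) (h g')).

Lemma hom_tone h : torus_hom h -> h 1T = 1T.
Proof.
move=> [hT hM]; apply: (tmulI (hT _ (@torus1 R n))).
by rewrite -hM ?tmul1 ?tmulr1 //; exact: torus1.
Qed.

(** Near [g], [h] is multiplication by the inverse of [g], then [h] near 1, then multiplication by
    [h g]; both multiplications are linear maps of C^n. *)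
Lemma hom_is_diff h g : torus_hom h -> differentiable h 1T -> torus g ->
  is_diff g h (fun v => tmul (h g) ('d h 1T (tmul (tinv g) v))).
Proof.
move=> [hT hM] dh tg.
have d1 : is_diff (tmul (tinv g) g) h ('d h 1T).
  by rewrite tmulV //; exact: differentiableP.
have D := is_diff_comp (is_diff_comp (linear_Cn_is_diff (tmul (tinv g)) g) d1)
                       (linear_Cn_is_diff (tmul (h g)) _).
apply: near_is_diff D.
apply: (open_near (@open_torus R n) tg) => w tw /=.
have tw' := torusM (torusV tg) tw.
by rewrite -hM // tmulA (tmulC g) tmulV // tmul1.
Qed.

(* Both sides of [h (cexp (s u)) = cexp (s L u)] solve the same linear differential
   equation in [s]. *)
Lemma hom_cexp h u : torus_hom h -> differentiable h 1T ->
  h (cexp u) = cexp ('d h 1T u).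
Proof.
move=> hh dh; have [hT hM] := hh.
pose y (s : R) := h (cexp (s *: u)).
have dy s : is_diff s y (fun t => tmul (y s) ('d h 1T (t *: u))).
  have d0 : is_diff (s - s) (fun t : R => cexp (t *: u)) (fun t => t *: u).
    by rewrite subrr; exact: is_diff_cexp_line.
  have d1 : is_diff (cexp ((s - s) *: u)) h ('d h 1T).
    by rewrite subrr scale0r cexp0; exact: differentiableP.
  have ds : is_diff s (fun t : R => t - s) id.
    apply: is_diff_eq (is_diffB (is_diff_id s) (is_diff_cst s s)) _.
    by apply/funext => t; rewrite !fctE subr0.
  have D := is_diff_comp (is_diff_comp (is_diff_comp ds d0) d1)
              (linear_Cn_is_diff (tmul (y s)) _).
  apply: near_is_diff D; apply: (@filterE _ (nbhs s)) => t /=.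
  rewrite /y -hM; try exact: torus_cexp.
  by rewrite -cexpD -scalerDl addrC subrK.
apply: crdP => k; rewrite cexpE.
case E : (crd ('d h 1T u) k) => [a b].
pose p s := complex.Re (crd (y s) k); pose q s := complex.Im (crd (y s) k).
have dk (s : R) : crd (tmul (y s) ('d h 1T ((1 : R) *: u))) k = (p s +i* q s) * (a +i* b).
  by rewrite scale1r crdM E /p /q; case: (crd (y s) k).
have dp s : is_derive (s : R) (1 : R) p (a * p s - b * q s).
  have := is_diff_derive (1 : R) (is_diff_Re k (dy s)).
  by move=> H; apply: is_derive_eq H _; rewrite dk /=; ring.
have dq s : is_derive (s : R) (1 : R) q (b * p s + a * q s).
  have := is_diff_derive (1 : R) (is_diff_Im k (dy s)).
  by move=> H; apply: is_derive_eq H _; rewrite dk /=; ring.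
have y0 : y 0 = 1T by rewrite /y scale0r cexp0 hom_tone.
have p0 : p 0 = 1 by rewrite /p y0 crd1.
have q0 : q 0 = 0 by rewrite /q y0 crd1.
have := linear_ode dp dq p0 q0 1; rewrite mul1r => <-.
by rewrite /p /q /y scale1r; case: (crd _ k).
Qed.

Lemma differentiable_sqr (V : normedModType R) (f : V -> R) x :
  differentiable f x -> differentiable (fun t => f t ^+ 2) x.
Proof.
move=> df; have := differentiableM df df.
by congr (differentiable _ _); apply/funext => t; rewrite expr2.
Qed.

Lemma torus_hom_tinv : torus_hom (@tinv R n).
Proof.
split=> [g|g g' tg tg']; first exact: torusV.
by apply: crdP => k; rewrite !crdE invfM.
Qed.

Lemma differentiable_tinv1 : differentiable (@tinv R n) 1T.
Proof.
have dR k := is_diff_Re k (is_diff_id 1T).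
have dI k := is_diff_Im k (is_diff_id 1T).
have dN k : differentiable (fun w : Cn R n => (complex.Re (crd w k) ^+ 2 + complex.Im (crd w k)
    ^+ 2)^-1) 1T.
  apply: (@differentiableV _ _ (fun w : Cn R n => complex.Re (crd w k) ^+ 2 +
      complex.Im (crd w k) ^+ 2)); last first.
    by rewrite crd1 /= expr0n addr0 expr1n oner_neq0.
  have [h1 _] := dR k; have [h2 _] := dI k.
  exact: (differentiableD (differentiable_sqr h1) (differentiable_sqr h2)).
apply: differentiable_Cn => k.
  have [h1 _] := dR k; have := differentiableM h1 (dN k).
  congr (differentiable _ _); apply/funext => w.
  by rewrite !fctE crdV; case: (crd w k).
have [h1 _] := dI k; have := differentiableM (differentiableN h1) (dN k).
congr (differentiable _ _); apply/funext => w.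
by rewrite !fctE crdV; case: (crd w k) => a b /=; rewrite mulNr.
Qed.

Lemma hom_CkS k h : torus_hom h -> differentiable h 1T ->
  Ck_on k (@torus R n) (@tinv R n) -> Ck_on k (@torus R n) h ->
  Ck_on k.+1 (@torus R n) h.
Proof.
move=> hh dh Ci Ch; split=> [g tg|v].
  by have [] := hom_is_diff hh dh tg.
have lD : linear (fun w => 'd h 1T (tmul w v)).
  have -> : (fun w => 'd h 1T (tmul w v)) = 'd h 1T \o tmul v.
    by apply/funext => w /=; rewrite tmulC.
  exact: linearP.
have := Ck_tmul (@open_torus R n) Ch (Ck_linear_l lD (@open_torus R n) Ci).
apply: Ck_ext; first exact: open_torus.
move=> g tg; have [_ E] := hom_is_diff hh dh tg.
exact: (esym (congr1 (fun F => F v) E)).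
Qed.

(* The differential of [h] at [g] is [v |-> h g * dh_1 (g^-1 v)], which is C^k when
   [h] is: differentiability at 1 alone bootstraps to smoothness. *)
Lemma hom_smooth h : torus_hom h -> differentiable h 1T -> smooth_on (@torus R n) h.
Proof.
have Ch f : torus_hom f -> differentiable f 1T -> Ck_on 0 (@torus R n) f.
  move=> hf df g tg; apply: differentiable_continuous.
  by have [] := hom_is_diff hf df tg.
(* The derivative of [h] involves [tinv], which is itself a homomorphism and so is smooth by the
   same bootstrap. *)
have Ci : smooth_on (@torus R n) (@tinv R n).
  elim=> [|k IH]; first exact: (Ch _ torus_hom_tinv differentiable_tinv1).
  exact: (hom_CkS torus_hom_tinv differentiable_tinv1 IH IH).
move=> hh dh; elim=> [|k IH]; first exact: (Ch h hh dh).
exact: (hom_CkS hh dh (Ci k) IH).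
Qed.

(** The principal logarithm on the half-plane Re z > 0, a neighbourhood of 1. *)
Definition clog1 (z : R[i]) : R[i] :=
  (2^-1 * ln (complex.Re z ^+ 2 + complex.Im z ^+ 2)) +i* atan (complex.Im z / complex.Re z).
Definition clog z : Cn R n := of_crd (fun k => clog1 (crd z k)).

Lemma cexp1_clog1 (z : R[i]) : 0 < complex.Re z -> cexp1 (clog1 z) = z.
Proof.
case: z => x y /= x0; rewrite /cexp1 /clog1 /=.
have r0 : 0 < x ^+ 2 + y ^+ 2 by rewrite ltr_wpDr ?sqr_ge0 // exprn_gt0.
pose r := Num.sqrt (x ^+ 2 + y ^+ 2).
have rp : 0 < r by rewrite sqrtr_gt0.
have er : expR (2^-1 * ln (x ^+ 2 + y ^+ 2)) = r.
  have -> : x ^+ 2 + y ^+ 2 = r ^+ 2 by rewrite sqr_sqrtr // ltW.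
  by rewrite lnXn // -[ln r *+ 2]mulr_natl mulKf ?pnatr_eq0 // lnK.
have c : cos (atan (y / x)) = x / r.
  rewrite cos_atan; have -> : 1 + (y / x) ^+ 2 = (r / x) ^+ 2.
    rewrite !expr_div_n sqr_sqrtr ?(ltW r0) // mulrDl divff //.
    by rewrite expf_neq0 // gt_eqF.
  by rewrite sqrtr_sqr gtr0_norm ?divr_gt0 // invf_div.
have s : sin (atan (y / x)) = y / r.
  have := atanK (y / x); rewrite /tan c => /(congr1 (fun t => t * (x / r))).
  rewrite divfK; last by rewrite mulf_neq0 ?invr_eq0 ?gt_eqF.
  by rewrite mulrA divfK // gt_eqF.
by rewrite er c s ![r * _]mulrC !divfK // gt_eqF.
Qed.

Lemma differentiable_clog1 : differentiable clog 1T.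
Proof.
have dR k := is_diff_Re k (is_diff_id 1T).
have dI k := is_diff_Im k (is_diff_id 1T).
have dN k : differentiable (fun w : Cn R n => complex.Re (crd w k) ^+ 2 + complex.Im (crd w k)
    ^+ 2) 1T.
  have [h1 _] := dR k; have [h2 _] := dI k.
  exact: (differentiableD (differentiable_sqr h1) (differentiable_sqr h2)).
have dQ k : differentiable (fun w : Cn R n => complex.Im (crd w k) / complex.Re (crd w k)) 1T.
  have [h1 _] := dR k; have [h2 _] := dI k.
  apply: (differentiableM h2).
  by apply: (differentiableV h1); rewrite crd1 /= oner_neq0.
apply: differentiable_Cn => k.
  have h : differentiable (@ln R) (complex.Re (crd 1T k) ^+ 2 + complex.Im (crd 1T k) ^+ 2).
    rewrite crd1 /= expr0n addr0 expr1n.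
    by have [] := is_diff1 (is_derive1_ln (@ltr01 R)).
  have := differentiableZ 2^-1 (differentiable_comp (dN k) h).
  congr (differentiable _ _); apply/funext => w.
  by rewrite !fctE crd_of.
have h : differentiable (@atan R) (complex.Im (crd 1T k) / complex.Re (crd 1T k)).
  by have [] := is_diff1 (is_derive1_atan (complex.Im (crd 1T k) / complex.Re (crd 1T k))).
have := differentiable_comp (dQ k) h.
congr (differentiable _ _); apply/funext => w.
by rewrite crd_of.
Qed.

Lemma linear_injective_inverse (L : {linear Cn R n -> Cn R n}) :
  (forall u, L u = 0 -> u = 0) ->
  exists L' : {linear Cn R n -> Cn R n}, forall u, L (L' u) = u.
Proof.
move=> inj; pose f := linfun L.
have fi : lker f == 0%VS.
  apply/lker0P => u v; rewrite !lfunE /= => h.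
  by apply/eqP; rewrite -subr_eq0; apply/eqP/inj; rewrite linearB /= h subrr.
exists (f^-1)%VF => u; rewrite -[L _](lfunE L) limg_lfunVK //.
have := lker0_limgf fi; rewrite -/f => ->; exact: memvf.
Qed.

(* Near 1 the inverse is [cexp \o L^-1 \o clog] with [L = dh_1], so no inverse
   function theorem is needed. *)
Lemma hom_inverse_smooth h s : torus_hom h -> differentiable h 1T -> torus_hom s ->
  (forall g, torus g -> s (h g) = g) -> smooth_on (@torus R n) s.
Proof.
move=> hh dh hs sh.
have [|L' hL'] := @linear_injective_inverse ('d h 1T).
  move=> u Lu.
  (* If the differential kills [u], then [h] is trivial on the whole one-parameter group of [u], and
     so is [s] composed with [h], which is the identity. *)
  have e1 (t : R) : cexp (t *: u) = 1T.
    rewrite -[LHS]sh; last exact: torus_cexp.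
    by rewrite hom_cexp // linearZ /= Lu scaler0 cexp0 hom_tone.
  apply: crdP => k; rewrite crd0; case E : (crd u k) => [a b].
  have e2 (t : R) : cexp1 (t%:C * (a +i* b)) = 1.
    by move: (congr1 (fun z => crd z k) (e1 t)); rewrite cexpE crdZ E crd1.
  have [m] := cexp1_eq1 (e2 1); rewrite mul1r => -[a0 _]; rewrite a0 in e2 *.
  have [->//|b0] := eqVneq b 0.
  (* Time 1 has shown that the exponent is purely imaginary; at time pi / b the exponential would be
     -1. *)
  have := e2 (pi / b); rewrite /cexp1 /= !mul0r; rewrite mulr0 subr0 addr0 divfK // expR0 cospi.
  by case; rewrite mul1r => /eqP; rewrite eqNr oner_eq0.
apply: hom_smooth => //.
have D : differentiable (@cexp R n \o (L' \o clog)) 1T.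
  apply: differentiable_comp; last exact: differentiable_cexp.
  apply: differentiable_comp; first exact: differentiable_clog1.
  by have [] := linear_Cn_is_diff L' (clog 1T).
have [] // : is_diff 1T s ('d (@cexp R n \o (L' \o clog)) 1T).
apply: near_is_diff (differentiableP D).
have P : \forall w \near 1T, forall k, 0 < complex.Re (crd w k).
  apply: (@filter_forall _ _ (fun k w => 0 < complex.Re (crd w k)) (nbhs 1T)) => k.
  apply: (cvgr_gt _ (@continuous_Re R n k 1T)).
  by rewrite crd1 ltr01.
apply: filterS P => w wp /=.
rewrite -[LHS]sh; last exact: torus_cexp.
rewrite hom_cexp // hL'; congr s; apply: crdP => k.
by rewrite cexpE crd_of cexp1_clog1.
Qed.

(* Locked, since conversion would otherwise unfold the products when it compares
   [mono M z] with [mono M w]. *)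
Fact mono_key : unit. Proof. exact: tt. Qed.
Definition mono := locked_with mono_key (fun (M : 'M[int]_n) z =>
  of_crd (fun l => \prod_k crd z k ^ M k l)).

Lemma monoE M z l : crd (mono M z) l = \prod_k crd z k ^ M k l.
Proof. by rewrite /mono unlock crd_of. Qed.

(* [h (cexp u) = cexp (L u)] with [L = dh_1] complex linear; since [cexp] has period
   2 pi i in each coordinate, the entries of [L] are integers. *)
Lemma hom_mono h : torus_hom h -> differentiable h 1T ->
  (forall v, 'd h 1T (mulI v) = mulI ('d h 1T v)) ->
  exists M, forall z, torus z -> h z = mono M z.
Proof.
move=> hh dh hI; set L := 'd h 1T.
have Lint k l : exists m : int, crd (L (unitv 1 k)) l = m%:~R.
  have e1 : cexp (L (unitv (0 +i* (pi *+ 2)) k)) = 1T.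
    rewrite -hom_cexp //; have -> : cexp (unitv (0 +i* (pi *+ 2)) k) = 1T.
      by apply: crdP => j; rewrite cexpE crd1 crd_of; case: eqP => _; rewrite ?cexp1_2pi ?cexp10.
    exact: hom_tone.
  have e2 : unitv (0 +i* (pi *+ 2)) k = (pi *+ 2) *: mulI (unitv 1 k) :> Cn R n.
    apply: crdP => j; rewrite !crdE; case: eqP => _; last by rewrite !mulr0.
    by rewrite mulr1; apply/eqP; rewrite eq_complex /=; apply/andP; split; apply/eqP; ring.
  move: e1; rewrite e2 linearZ /= hI => /(congr1 (fun z => crd z l)).
  rewrite cexpE crd1 crdZ crdI; case E : (crd _ l) => [a b].
  move=> /cexp1_eq1[m] /eqP; rewrite eq_complex /= => /andP[/eqP h1 /eqP h2].
  have p2 : pi *+ 2 != 0 :> R by rewrite mulrn_eq0 /= gt_eqF // pi_gt0.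
  exists m; have -> : b = 0.
    by apply: (mulfI p2); lra.
  have -> : a = m%:~R by apply: (mulfI p2); lra.
  by rewrite complexr0 rmorph_int.
pose M : 'M[int]_n := \matrix_(k, l) xget 0 [set m : int | crd (L (unitv 1 k)) l = m%:~R].
have LM k l : crd (L (unitv 1 k)) l = (M k l)%:~R.
  by rewrite mxE; have [m hm] := Lint k l;
      exact: (xgetI 0 (hm : [set m : int | crd (L (unitv 1 k)) l = m%:~R] m)).
exists M => z /cexp_surj[u <-]; rewrite hom_cexp //; apply: crdP => l.
rewrite cexpE monoE.
have -> : crd (L u) l = \sum_k (M k l)%:~R * crd u k.
  rewrite {1}[u]CnE linear_sum crd_sum; apply: eq_bigr => k _.
  rewrite linearD !linearZ /=.
  have -> : unitv 'i k = mulI (unitv 1 k) :> Cn R n.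
    by apply: crdP => j; rewrite !crdE; case: eqP => _; rewrite ?mulr1 ?mulr0.
  rewrite hI -/L crdD !crdZ crdI LM mulrA -mulrDl mulrC; congr (_ * _).
  by rewrite [RHS]complexE [X in _ + X = _]mulrC.
by rewrite cexp1_sum; apply: eq_bigr => k _; rewrite cexp1_int cexpE.
Qed.

End TorusHomomorphisms.

(** * Charts and tangent vectors *)

Section Charts.
Variables (R : realType) (n : nat) (X : topologicalType).
Implicit Types (b c d : chart R n X) (p x : X).

Lemma dom_open b : open (dom b). Proof. exact: open_dom. Qed.

Lemma cod_open b : open (cod b). Proof. exact: open_cod. Qed.

Lemma to_from b z : cod b z -> to b (from b z) = z.
Proof. by move=> [x dx <-]; rewrite toK. Qed.

Lemma dom_from b z : cod b z -> dom b (from b z).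
Proof. by move=> [x dx <-]; rewrite toK. Qed.

Lemma cod_to b x : dom b x -> cod b (to b x).
Proof. by move=> dx; exists x. Qed.

Lemma image_toE b (V : set X) : to b @` (dom b `&` V) = cod b `&` from b @^-1` V.
Proof.
rewrite predeqE => z; split=> [[x [dx Vx] <-]|[cz Vz]].
  by split; [exact: cod_to|rewrite /preimage /= toK].
by exists (from b z); [split=> //; exact: dom_from|exact: to_from].
Qed.

Lemma open_image_to b (V : set X) : open V -> open (to b @` (dom b `&` V)).
Proof.
move=> oV; rewrite image_toE openE => z [cz Vz].
have n1 : nbhs z (cod b) by apply: open_nbhs_nbhs; split=> //; exact: cod_open.
have n2 : nbhs z (from b @^-1` V).
  by apply: (from_continuous cz); apply: open_nbhs_nbhs.
exact: (@filterI _ (nbhs z) _ _ _ n1 n2).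
Qed.

Lemma near_to b (V : set X) p : open V -> dom b p -> V p ->
  \forall z \near to b p, cod b z /\ V (from b z).
Proof.
move=> oV dp Vp; have := open_image_to (b := b) oV; rewrite image_toE => oW.
apply: open_nbhs_nbhs; split=> //; split; first exact: cod_to.
by rewrite /preimage /= toK.
Qed.

Lemma near_change (b c : chart R n X) p : dom b p -> dom c p ->
  \forall z \near to b p, [/\ cod b z, dom b (from b z) & dom c (from b z)].
Proof.
move=> bp cp; apply: filterS (near_to (dom_open c) bp cp) => z [cz dz].
by split=> //; exact: dom_from.
Qed.

End Charts.

Section LinearChart.
Variables (R : realType) (n : nat) (X : topologicalType).
Variables (L L' : {linear Cn R n -> Cn R n}).
Hypotheses (LK : cancel L L') (LK' : cancel L' L).

Section Construction.
Variable b : chart R n X.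

Lemma lin_codE : (L \o to b) @` dom b = L' @^-1` cod b.
Proof.
rewrite predeqE => z; split=> [[x dx <-]|[x dx e]].
  by rewrite /preimage /= LK; exact: cod_to.
by exists x => //=; rewrite e LK'.
Qed.

Lemma lin_open_cod : open ((L \o to b) @` dom b).
Proof.
rewrite lin_codE; apply: open_comp; last exact: cod_open.
by move=> z _; exact: linear_Cn_continuous.
Qed.

Lemma lin_toK x : dom b x -> (from b \o L') ((L \o to b) x) = x.
Proof. by move=> dx; rewrite /= LK toK. Qed.

Lemma lin_to_continuous x : dom b x -> {for x, continuous (L \o to b)}.
Proof.
move=> dx; apply: continuous_comp; first exact: to_continuous.
exact: linear_Cn_continuous.
Qed.

Lemma lin_from_continuous z : ((L \o to b) @` dom b) z -> {for z, continuous (from b \o L')}.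
Proof.
rewrite lin_codE => dz; apply: continuous_comp; first exact: linear_Cn_continuous.
exact: from_continuous.
Qed.

(** Serves twice: for conjugating and rescaling coordinates, and for permuting them. *)
Definition lin_chart : chart R n X :=
  Chart (dom_open b) lin_open_cod lin_toK lin_to_continuous lin_from_continuous.

End Construction.

Lemma lin_chart_smooth (A : set (chart R n X)) b :
  smooth_chart A b -> smooth_chart A (lin_chart b).
Proof.
move=> sb a Aa; have [ab ba] := sb a Aa; split=> k.
  apply: Ck_linear_l (ab k); first exact: linearP.
  exact: (open_image_to (b := a) (dom_open b)).
have := Ck_linear_r L' (open_image_to (b := b) (dom_open a)) (ba k).
apply: Ck_sub => z [x [bx ax] <-]; exists x => //=.
Qed.

End LinearChart.

(** * Tangent vectors read in arbitrary smooth charts *)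

Section Tangents.
Variables (R : realType) (n : nat) (X : topologicalType) (A : set (chart R n X)).
Hypothesis atlasA : smooth_atlas A.
Implicit Types (b c d : chart R n X) (p x : X) (u : Cn R n).

Lemma atlas_smooth_chart a : A a -> smooth_chart A a.
Proof. by move=> Aa c Ac; split; apply: atlasA.2. Qed.

(** Charts of the maximal atlas are compared with those of [A] only, so the change from [b] to [c]
    is factored near [p] through a chart of [A]. *)
Lemma change_differentiable b c p : smooth_chart A b -> smooth_chart A c ->
  dom b p -> dom c p -> differentiable (to c \o from b) (to b p).
Proof.
move=> sb sc bp cp; have [a Aa ap] := atlasA.1 p.
have [/(_ 1%N)[d1 _] _] := sc a Aa; have [_ /(_ 1%N)[d2 _]] := sb a Aa.
have e1 : is_diff (to b p) (to a \o from b) ('d (to a \o from b) (to b p)).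
  apply: differentiableP; apply: d2; by exists p.
have e2 : is_diff ((to a \o from b) (to b p)) (to c \o from a) ('d (to c \o from a) (to a p)).
  rewrite /= (toK bp); apply: differentiableP; apply: d1; by exists p.
suff [] : is_diff (to b p) (to c \o from b) ('d (to c \o from a) (to a p)
    \o 'd (to a \o from b) (to b p)) by [].
apply: near_is_diff (is_diff_comp e1 e2).
apply: filterS (near_change bp ap) => z [cz bz az] /=.
by rewrite toK.
Qed.

Lemma change_comp b c d p u : smooth_chart A b -> smooth_chart A c -> smooth_chart A d ->
  dom b p -> dom c p -> dom d p ->
  'd (to d \o from b) (to b p) u =
  'd (to d \o from c) (to c p) ('d (to c \o from b) (to b p) u).
Proof.
move=> sb sc sd bp cp dp.
have e1 := differentiableP (change_differentiable sb sc bp cp).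
have e2 : is_diff ((to c \o from b) (to b p)) (to d \o from c) ('d (to d \o from c) (to c p)).
  rewrite /= (toK bp); exact: (differentiableP (change_differentiable sc sd cp dp)).
have [_ E] : is_diff (to b p) (to d \o from b) ('d (to d \o from c) (to c p)
    \o 'd (to c \o from b) (to b p)).
  apply: near_is_diff (is_diff_comp e1 e2).
  apply: filterS (near_change bp cp) => z [cz bz az] /=.
  by rewrite toK.
exact: (congr1 (fun F => F u) E).
Qed.

Lemma change_id b p u : dom b p -> 'd (to b \o from b) (to b p) u = u.
Proof.
move=> bp; have [_ E] : is_diff (to b p) (to b \o from b) id.
  apply: near_is_diff (is_diff_id _).
  apply: filterS (near_change bp bp) => z [cz bz _] /=.
  by rewrite to_from.
exact: (congr1 (fun F => F u) E).
Qed.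

(** Rests on the components being fixed to 0 in all other charts, and on proof irrelevance. *)
Lemma tangent_eq p (v w : tangent A p) :
  (forall c, A c -> dom c p -> tcomp v c = tcomp w c) -> v = w.
Proof.
case: v w => [v v1 v2] [w w1 w2] /= h.
have e : v = w.
  apply/funext => c; have [[Ac cp]|nc] := pselect (A c /\ dom c p); first exact: h.
  by rewrite v2 // w2.
move: v1 v2 w1 w2; rewrite e => v1 v2 w1 w2.
by rewrite (Prop_irrelevance v1 w1) (Prop_irrelevance v2 w2).
Qed.

Section TangentVector.
Variables (b : chart R n X) (p : X).
Hypotheses (sb : smooth_chart A b) (bp : dom b p).

(** Components of the vector given by [u] in [b], a chart which may lie outside [A]; the default 0
    is the one imposed by [tcomp_out]. *)
Definition tvec_comp u c : Cn R n :=
  if pselect (A c /\ dom c p) then 'd (to c \o from b) (to b p) u else 0.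

Lemma tvec_change u c c' : A c -> A c' -> dom c p -> dom c' p ->
  tvec_comp u c' = 'd (to c' \o from c) (to c p) (tvec_comp u c).
Proof.
move=> Ac Ac' cp cp'; rewrite /tvec_comp.
case: pselect => [?|[]//]; case: pselect => [?|[]//].
by apply: change_comp => //; exact: atlas_smooth_chart.
Qed.

Lemma tvec_out u c : ~ (A c /\ dom c p) -> tvec_comp u c = 0.
Proof. by rewrite /tvec_comp; case: pselect. Qed.

Definition tvec u : tangent A p := Tangent (@tvec_change u) (@tvec_out u).

Lemma tvecE u c : A c -> dom c p -> tcomp (tvec u) c = 'd (to c \o from b) (to b p) u.
Proof. by move=> Ac cp; rewrite /= /tvec_comp; case: pselect => // -[]. Qed.

Lemma tvec_tcomp (v : tangent A p) c : A c -> dom c p ->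
  v = tvec ('d (to b \o from c) (to c p) (tcomp v c)).
Proof.
move=> Ac cp; apply: tangent_eq => d Ad dp; rewrite tvecE //.
have sc := atlas_smooth_chart Ac; have sd := atlas_smooth_chart Ad.
by rewrite -(change_comp _ sc sb sd cp bp dp) (tcomp_change v Ac Ad cp dp).
Qed.

Lemma tvec_inj : injective tvec.
Proof.
move=> u u' h; have [a Aa ap] := atlasA.1 p.
have sa := atlas_smooth_chart Aa.
have E w : 'd (to b \o from a) (to a p) (tcomp (tvec w) a) = w.
  rewrite (tvecE w Aa ap) -(change_comp w sb sa sb bp ap bp).
  exact: change_id.
by rewrite -(E u) h E.
Qed.

End TangentVector.

(** Components of [v] in a chart [b] that may lie outside [A], where [tcomp] says nothing. The
    auxiliary chart [c] is picked by choice; [tcoordE] shows that every choice gives the same value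
    when [b] is a smooth chart around [p]. *)
Definition tcoord b p (v : tangent A p) : Cn R n :=
  xget 0 [set u | exists (c : chart R n X),
     [/\ A c, dom c p & u = 'd (to b \o from c) (to c p) (tcomp v c)]].

Lemma tcoordP b p (v : tangent A p) : exists (c : chart R n X),
  [/\ A c, dom c p & tcoord b v = 'd (to b \o from c) (to c p) (tcomp v c)].
Proof.
have [a Aa ap] := atlasA.1 p.
rewrite /tcoord; set S := [set u | _].
have Su : S ('d (to b \o from a) (to a p) (tcomp v a)) by exists a; split.
exact: (xgetI 0 Su).
Qed.

Section Coordinates.
Variables (b : chart R n X) (p : X).
Hypotheses (sb : smooth_chart A b) (bp : dom b p).

Lemma tcoordK (v : tangent A p) : tvec sb bp (tcoord b v) = v.
Proof. by have [c [Ac cp ->]] := tcoordP b v; rewrite -(tvec_tcomp sb bp _ Ac cp). Qed.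

Lemma tvecK u : tcoord b (tvec sb bp u) = u.
Proof. by apply: (@tvec_inj b p sb bp); rewrite tcoordK. Qed.

Lemma tcoordE (v : tangent A p) c : A c -> dom c p ->
  tcoord b v = 'd (to b \o from c) (to c p) (tcomp v c).
Proof. by move=> Ac cp; apply: (@tvec_inj b p sb bp);
    rewrite tcoordK -(tvec_tcomp sb bp _ Ac cp). Qed.

Lemma tcoord_change c (v : tangent A p) : smooth_chart A c -> dom c p ->
  tcoord c v = 'd (to c \o from b) (to b p) (tcoord b v).
Proof.
move=> sc cp; have [a Aa ap] := atlasA.1 p; have sa := atlas_smooth_chart Aa.
have [a' [Aa' ap' ->]] := tcoordP c v.
rewrite (tcoordE v Aa' ap').
exact: (change_comp _ (atlas_smooth_chart Aa') sb sc ap' bp cp).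
Qed.

End Coordinates.

Lemma tcoord_lin (L L' : {linear Cn R n -> Cn R n}) (LK : cancel L L') (LK' : cancel L' L)
    b p (v : tangent A p) :
  smooth_chart A b -> dom b p ->
  tcoord (lin_chart LK LK' b) v = L (tcoord b v).
Proof.
move=> sb bp; have sl := lin_chart_smooth LK LK' sb.
rewrite (tcoord_change (b := b) sb bp v sl) //.
have e1 := differentiableP (change_differentiable sb sb bp bp).
have [_ E] := is_diff_comp e1 (linear_Cn_is_diff L _).
rewrite -[in RHS](change_id (tcoord b v) bp).
exact: (congr1 (fun F => F (tcoord b v)) E).
Qed.

Section Pushforward.
Variables (b : chart R n X) (f : X -> X) (t : Cn R n).
Hypotheses (sb : smooth_chart A b)
  (fb : forall x, dom b x -> dom b (f x) /\ to b (f x) = tmul t (to b x)).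

(** In the chart [b] the map [f] is linear, hence equal to its differential; the chain rule carries
    this to the charts of [A]. *)
Lemma pushforward_tvec p (bp : dom b p) (fbp : dom b (f p)) u :
  pushforward (tvec sb bp u) (tvec sb fbp (tmul t u)).
Proof.
move=> c c' Ac Ac' cp cp'; rewrite (tvecE sb bp _ Ac cp) (tvecE sb fbp _ Ac' cp').
have sc := atlas_smooth_chart Ac; have sc' := atlas_smooth_chart Ac'.
have e1 := differentiableP (change_differentiable sc sb cp bp).
have e2 := is_diff_comp e1 (linear_Cn_is_diff (tmul t) _).
have e3 : is_diff ((tmul t \o (to b \o from c)) (to c p)) (to c' \o from b)
    ('d (to c' \o from b) (to b (f p))).
  rewrite /= (toK cp) /= -(fb bp).2; exact: (differentiableP (change_differentiable sb sc' fbp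
      cp')).
have [_ E] : is_diff (to c p) (to c' \o f \o from c)
   ('d (to c' \o from b) (to b (f p)) \o (tmul t \o 'd (to b \o from c) (to c p))).
  apply: near_is_diff (is_diff_comp e2 e3).
  apply: filterS (near_change cp bp) => z [cz dz bz] /=.
  by have [bfz <-] := fb bz; rewrite toK.
have E1 : u = 'd (to b \o from c) (to c p) ('d (to c \o from b) (to b p) u) :=
  etrans (esym (change_id u bp)) (change_comp u sb sc sb bp cp bp).
apply: etrans (congr1 (fun w => 'd (to c' \o from b) (to b (f p)) (tmul t w)) E1) _.
exact: (esym (congr1 (fun F => F ('d (to c \o from b) (to b p) u)) E)).
Qed.

Lemma pushforward_tcoord p (v : tangent A p) (w : tangent A (f p)) :
  dom b p -> pushforward v w -> tcoord b w = tmul t (tcoord b v).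
Proof.
move=> bp vw; have [fbp _] := fb bp.
suff -> : w = tvec sb fbp (tmul t (tcoord b v)) by rewrite tvecK.
apply: tangent_eq => c' Ac' cp'; have [c Ac cp] := atlasA.1 p.
rewrite (vw c c' Ac Ac' cp cp') -{1}(tcoordK sb bp v).
by rewrite (pushforward_tvec bp fbp (tcoord b v) Ac Ac' cp cp').
Qed.

End Pushforward.

(** The differential of the chart change carries the expression of [J] in [b] to that in [c]. Both
    are multiplication by i, so it is complex linear. *)
Lemma commuting_holomorphic b c (J : forall p, tangent A p -> tangent A p) :
  smooth_chart A b -> smooth_chart A c ->
  (forall p (v : tangent A p), dom b p -> tcoord b (J p v) = mulI (tcoord b v)) ->
  (forall p (v : tangent A p), dom c p -> tcoord c (J p v) = mulI (tcoord c v)) ->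
  holomorphic_transition b c.
Proof.
move=> sb sc Jb Jc z [p [bp cp] <-]; split; first exact: change_differentiable.
move=> u; have := Jc p (tvec sb bp u) cp.
rewrite !(tcoord_change (b := b) sb bp _ sc cp) (Jb _ _ bp) (tvecK sb bp u); exact: id.
Qed.

Lemma inducing_tcoord (J : forall p, tangent A p -> tangent A p) b :
  smooth_chart A b ->
  (forall c p (v : tangent A p), A c -> dom b p -> dom c p ->
        'd (to b \o from c) (to c p) (tcomp (J p v) c) =
        mulI ('d (to b \o from c) (to c p) (tcomp v c))) <->
  (forall p (v : tangent A p), dom b p -> tcoord b (J p v) = mulI (tcoord b v)).
Proof.
move=> sb; split=> h.
  move=> p v bp; have [c Ac cp] := atlasA.1 p.
  by rewrite !(tcoordE sb bp _ Ac cp); exact: h.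
by move=> c p v Ac bp cp; rewrite -!(tcoordE sb bp _ Ac cp); exact: h.
Qed.

End Tangents.

(** * Invariant almost complex structures *)

Section InvariantStructure.
Variables (R : realType) (n : nat) (X : topologicalType) (A : set (chart R n X)).
Hypothesis atlasA : smooth_atlas A.
Variables (act : Cn R n -> X -> X) (J : forall p, tangent A p -> tangent A p).
Hypothesis acJ : almost_complex_structure J.
Hypothesis invJ : forall g, torus g -> invariant_under (act g) J.
Variables (c : chart R n X) (chi : 'I_n -> Cn R n -> R[i]).
Hypothesis repc : representation_chart A act chi c.
Hypothesis chi_surj :
  forall t, torus t -> exists2 g, torus g & forall k, chi k g = crd t k.

Let sc : smooth_chart A c := let: And4 s _ _ _ := repc in s.

Lemma rep_dom_from z : dom c (from c z).
Proof. by case: repc => _ e _ _; apply: dom_from; rewrite e. Qed.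

Lemma rep_to_from z : to c (from c z) = z.
Proof. by case: repc => _ e _ _; apply: to_from; rewrite e. Qed.

Definition chart_J z u : Cn R n :=
  tcoord c (J (tvec atlasA sc (rep_dom_from z) u)).

Lemma chart_JE p (v : tangent A p) : dom c p ->
  tcoord c (J v) = chart_J (to c p) (tcoord c v).
Proof.
move=> cp; rewrite /chart_J; move: (rep_dom_from (to c p)).
by rewrite toK // => cp'; rewrite tcoordK.
Qed.

(** Linearity and smoothness of [J] are given in the charts of [A] only; conjugation by the chart
    change brings them to [c]. *)
Lemma chart_J_atlas a z (F : Cn R n -> {linear Cn R n -> Cn R n}) :
  A a -> dom a (from c z) ->
  (forall p (v : tangent A p), dom a p -> tcomp (J v) a = F (to a p) (tcomp v a)) ->
  forall u, chart_J z u =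
   'd (to c \o from a) (to a (from c z))
      (F (to a (from c z)) ('d (to a \o from c) z u)).
Proof.
move=> Aa ap hF u; have cp := rep_dom_from z.
rewrite /chart_J (tcoordE atlasA sc cp _ Aa ap) (hF _ _ ap).
rewrite (tvecE atlasA sc (rep_dom_from z) u Aa ap).
exact: (congr1 (fun w => 'd (to c \o from a) (to a (from c z))
  (F (to a (from c z)) ('d (to a \o from c) w u))) (rep_to_from z)).
Qed.

Lemma chart_J_linear z : linear (chart_J z).
Proof.
have [a Aa ap] := atlasA.1 (from c z).
have [F [_ hF]] := acJ.1 a Aa.
pose M : {linear Cn R n -> Cn R n} :=
  'd (to c \o from a) (to a (from c z)) \o (F (to a (from c z)) \o 'd (to a \o from c) z).
have E u : chart_J z u = M u by exact: chart_J_atlas.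
by move=> k u v; rewrite !E; exact: (linearP M).
Qed.

Lemma chart_J_sq z u : chart_J z (chart_J z u) = - u.
Proof.
have cp := rep_dom_from z.
have E := chart_JE (J (tvec atlasA sc (rep_dom_from z) u)) cp; rewrite rep_to_from in E.
rewrite -[chart_J z u]/(tcoord c (J (tvec atlasA sc (rep_dom_from z) u))) -E.
have [a Aa ap] := atlasA.1 (from c z).
rewrite (tcoordE atlasA sc cp _ Aa ap) acJ.2.
apply: etrans (linearN ('d (to c \o from a) (to a (from c z))) _) _.
by rewrite -(tcoordE atlasA sc cp _ Aa ap) tvecK.
Qed.

Lemma chart_J_equivariant t z u : torus t ->
  chart_J (tmul t z) (tmul t u) = tmul t (chart_J z u).
Proof.
move=> tt; have [g tg gt] := chi_surj tt.
have [_ _ ds eq] := repc.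
have fb x : dom c x -> dom c (act g x) /\ to c (act g x) = tmul t (to c x).
  move=> cx; split; first exact: ds.
  by apply: crdP => k; rewrite eq // crdM gt.
have cp := rep_dom_from z; have [cgp tgp] := fb _ cp.
have pf := pushforward_tvec atlasA sc fb cp cgp u.
have := pushforward_tcoord atlasA sc fb cp (invJ tg pf).
by rewrite !chart_JE // !tvecK tgp !rep_to_from.
Qed.

(** In finite dimension, convergence of the linear maps on a basis controls their values at a moving
    argument. *)
Lemma cvg_linear_family (T : Type) (F : set_system T) {FF : Filter F}
    (G : T -> {linear Cn R n -> Cn R n}) (G0 : {linear Cn R n -> Cn R n}) (w : T -> Cn R n) w0 :
  (forall v, G t v @[t --> F] --> G0 v) -> w @ F --> w0 ->
  (fun t => G t (w t)) @ F --> G0 w0.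
Proof.
move=> hG hw.
have LE (L : {linear Cn R n -> Cn R n}) u :
    L u = \sum_k (complex.Re (crd u k) *: L (unitv 1 k) +
                  complex.Im (crd u k) *: L (unitv 'i k)).
  by rewrite {1}[u]CnE linear_sum; apply: eq_bigr => k _; rewrite linearD !linearZ.
rewrite LE; under eq_cvg do rewrite LE.
apply: cvg_sumr => k; apply: cvgD; apply: cvgZ; try exact: hG.
  exact: (cvg_comp _ _ hw (@continuous_Re R n k w0)).
exact: (cvg_comp _ _ hw (@continuous_Im R n k w0)).
Qed.

Lemma chart_J_continuous z0 u : chart_J z u @[z --> z0] --> chart_J z0 u.
Proof.
have cp := rep_dom_from z0; have [a Aa ap] := atlasA.1 (from c z0).
have [F [sF hF]] := acJ.1 a Aa; have [sac sca] := sc Aa.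
set p0 := from c z0 in cp ap.
have z0E : to c p0 = z0 by rewrite rep_to_from.
have ch : {for z0, continuous (to a \o from c)}.
  have := change_differentiable atlasA sc (atlas_smooth_chart atlasA Aa) cp ap.
  by rewrite z0E; exact: differentiable_continuous.
have c1 v : 'd (to c \o from a) ((to a \o from c) z) v @[z --> z0]
     --> 'd (to c \o from a) (to a p0) v.
  have [_ /(_ v) Cv] := sac 1%N.
  have H : {for to a p0, continuous (fun z => 'd (to c \o from a) z v)}.
    by apply: Cv; exists p0.
  exact: (cvg_comp _ _ ch H).
have c2 v : F ((to a \o from c) z) v @[z --> z0] --> F (to a p0) v.
  have H : {for to a p0, continuous (fun z => F z v)}.
    by apply: (sF v 0%N); apply: cod_to.
  exact: (cvg_comp _ _ ch H).
have c3 : 'd (to a \o from c) z u @[z --> z0] --> 'd (to a \o from c) z0 u.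
  have [_ /(_ u) Cu] := sca 1%N.
  by apply: Cu; exists p0.
have H : 'd (to c \o from a) ((to a \o from c) z)
      (F ((to a \o from c) z) ('d (to a \o from c) z u)) @[z --> z0] -->
    'd (to c \o from a) (to a p0) (F (to a p0) ('d (to a \o from c) z0 u)).
  exact: (cvg_linear_family c1 (cvg_linear_family c2 c3)).
have E0 := chart_J_atlas Aa ap hF u.
suff H' : chart_J z u @[z --> z0] --> 'd (to c \o from a) (to a p0) (F (to a p0)
    ('d (to a \o from c) z0 u)).
  by rewrite E0.
apply: (cvg_trans _ H); apply: (@near_eq_cvg _ _ (nbhs z0)).
have := near_change cp ap; rewrite z0E.
apply: filterS => z [_ cz az].
exact: (esym (chart_J_atlas Aa az hF u)).
Qed.

Definition scal (a : R[i]) : Cn R n := of_crd (fun=> a).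

(* Real scalings commute with the linear map [chart_J z], so [chart_J] is constant
   on the ray from the origin to [z]. *)
Lemma chart_J_const z u : chart_J z u = chart_J 0 u.
Proof.
have near_pos : \forall s \near (0 : R)^'+, chart_J z u = chart_J (s *: z) u.
  near=> s; have s0 : 0 < s by near: s; exact: nbhs_right_gt.
  have tT : torus (scal s%:C) by move=> k; rewrite crd_of; move: s0; apply: contraTneq =>
      -[->]; rewrite ltxx.
  have tE w : tmul (scal s%:C) w = s *: w by apply: crdP => k; rewrite !crdE.
  have := chart_J_equivariant z u tT; rewrite !tE.
  have lZ : chart_J (s *: z) (s *: u) = s *: chart_J (s *: z) u.
    have lJ := chart_J_linear (s *: z).
    have J0 : chart_J (s *: z) 0 = 0.
      by have := lJ 1 0 0; rewrite scale1r addr0 scale1r => /eqP;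
          rewrite -subr_eq0 opprD addNKr oppr_eq0 => /eqP.
    by have := lJ s u 0; rewrite !addr0 J0 addr0.
  by rewrite lZ => /(scalerI (lt0r_neq0 s0)) ->.
have c0 : chart_J (s *: z) u @[s --> (0 : R)^'+] --> chart_J 0 u.
  have : s *: z @[s --> (0 : R)^'+] --> (0 : R) *: z.
    by apply: cvgZr_tmp; exact: cvg_at_right_filter.
  rewrite scale0r => h; exact: (cvg_comp _ _ h (@chart_J_continuous 0 u)).
have c1 : chart_J (s *: z) u @[s --> (0 : R)^'+] --> chart_J z u.
  exact: (cvg_trans (near_eq_cvg near_pos) (cvg_cst (chart_J z u))).
exact: (cvg_unique _ c1 c0).
Unshelve. all: by end_near. Qed.

Lemma invariant_structure_diagonal : exists e : 'I_n -> bool,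
  forall p (v : tangent A p), dom c p -> forall k,
    crd (tcoord c (J v)) k = (if e k then 'i else - 'i) * crd (tcoord c v) k.
Proof.
pose lJ := GRing.isLinear.Build _ _ _ _ _ (chart_J_linear 0).
pose L : {linear Cn R n -> Cn R n} := HB.pack (chart_J 0) lJ.
have L_eq t u : torus t -> L (tmul t u) = tmul t (L u).
  by move=> tt; have := chart_J_equivariant 0 u tt; rewrite tmulr0.
have L_off u k : crd u k = 0 -> crd (L u) k = 0.
  (* This [t] fixes [u], so it fixes [L u], whose [k]-th coordinate it also doubles. *)
  move=> u0; pose t : Cn R n := of_crd (fun l => if l == k then 2 else 1).
  have tt : torus t by move=> l; rewrite crd_of; case: ifP => _;
      [rewrite pnatr_eq0|exact: oner_neq0].
  have tu : tmul t u = u.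
    apply: crdP => l; rewrite crdM crd_of; case: eqP => [->|_]; last by rewrite mul1r.
    by rewrite u0 mulr0.
  have := L_eq t u tt; rewrite tu => /(congr1 (fun z => crd z k)).
  rewrite crdM crd_of eqxx mulr_natl mulr2n => /eqP.
  by rewrite -subr_eq0 opprD addNKr oppr_eq0 => /eqP.
pose lam k := crd (L (unitv 1 k)) k.
have L_diag u k : crd (L u) k = crd u k * lam k.
  have [u0|u0] := eqVneq (crd u k) 0; first by rewrite L_off // u0 mul0r.
  (* [t] moves the [k]-th unit vector to one that has the same [k]-th coordinate as [u]; by [L_off]
     the remaining difference is invisible in coordinate [k]. *)
  pose t : Cn R n := of_crd (fun l => if l == k then crd u k else 1).
  have tt : torus t by move=> l; rewrite crd_of; case: ifP => _ //; exact: oner_neq0.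
  have rk : crd (u - tmul t (unitv 1 k)) k = 0.
    by rewrite crdB crdM !crd_of eqxx mulr1 subrr.
  have Eu : crd (L u) k = crd (L (tmul t (unitv 1 k))) k.
    apply/eqP; rewrite -subr_eq0 -crdB -linearB; apply/eqP; exact: L_off.
  by rewrite Eu L_eq // crdM crd_of eqxx.
have lam2 k : lam k ^+ 2 = -1.
  have := congr1 (fun z => crd z k) (chart_J_sq 0 (unitv 1 k)).
  rewrite -[chart_J 0 _]/(L _) -[chart_J 0 _]/(L _) L_diag crdN crd_of eqxx => <-.
  by rewrite expr2.
exists (fun k => lam k == 'i) => p v cp k.
rewrite chart_JE // chart_J_const -[chart_J 0 _]/(L _) L_diag mulrC; congr (_ * _).
case: eqP => [//|/eqP h].
have : (lam k - 'i) * (lam k + 'i) = 0 by rewrite -subr_sqr lam2 sqr_i subrr.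
by move/eqP; rewrite mulf_eq0 subr_eq0 (negbTE h) /= addr_eq0 => /eqP.
Qed.

End InvariantStructure.

(** * Conjugation of selected coordinates *)

Section ConjugateScale.
Variables (R : realType) (n : nat).

Definition cj (e : bool) (a : R[i]) : R[i] := if e then a else a^*.

Lemma cjK e : involutive (cj e).
Proof. by case: e => a //; exact: conjcK. Qed.

Lemma cjM e : {morph cj e : a b / a * b}.
Proof. by case: e => a b //; exact: rmorphM. Qed.

Lemma cjD e : {morph cj e : a b / a + b}.
Proof. by case: e => a b //; exact: rmorphD. Qed.

Lemma cj_real e (s : R) : cj e s%:C = s%:C.
Proof. by case: e => //; exact: conjc_real. Qed.

Lemma cj_eq0 e a : (cj e a == 0) = (a == 0).
Proof. by case: e => //; exact: conjc_eq0. Qed.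

Variables (e : 'I_n -> bool) (t : Cn R n).

(** Linear over the reals only. Conjugation corrects the complex structure, and the factor [t]
    normalizes the base point. *)
Definition cscale (z : Cn R n) : Cn R n := of_crd (fun k => crd t k * cj (e k) (crd z k)).
Definition cunscale (z : Cn R n) : Cn R n := of_crd (fun k => cj (e k) ((crd t k)^-1 * crd z k)).

Lemma cscale_is_linear : linear cscale.
Proof.
move=> a u v; apply: crdP => k; rewrite crdD crdZ !crd_of crdD crdZ cjD cjM cj_real mulrDr.
by rewrite mulrCA.
Qed.
HB.instance Definition _ :=
  GRing.isLinear.Build R (Cn R n) (Cn R n) _ cscale cscale_is_linear.

Lemma cunscale_is_linear : linear cunscale.
Proof.
move=> a u v; apply: crdP => k; rewrite crdD crdZ !crd_of crdD crdZ mulrDr cjD.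
by rewrite mulrCA [in LHS]cjM cj_real.
Qed.
HB.instance Definition _ :=
  GRing.isLinear.Build R (Cn R n) (Cn R n) _ cunscale cunscale_is_linear.

Lemma cscaleK : torus t -> cancel cscale cunscale.
Proof. by move=> tt z; apply: crdP => k; rewrite !crd_of mulKf // cjK. Qed.

Lemma cunscaleK : torus t -> cancel cunscale cscale.
Proof. by move=> tt z; apply: crdP => k; rewrite !crd_of cjK mulVKf. Qed.

End ConjugateScale.

(** * Equivariant holomorphic charts *)

Section Monomials.
Variables (R : realType) (n : nat).
Implicit Types (z : Cn R n) (M N : 'M[int]_n).

Lemma torus_mono M z : torus z -> torus (mono M z).
Proof. by move=> tz l; rewrite monoE; apply/prodf_neq0 => k _; rewrite expfz_neq0. Qed.

Lemma mono_tmul M z w : mono M (tmul z w) = tmul (mono M z) (mono M w).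
Proof.
apply: crdP => l; rewrite [RHS]crdM !monoE -big_split /=; apply: eq_bigr => k _.
by rewrite crdM expfzMl.
Qed.

Lemma prodr_exprz (K : fieldType) (x : K) (I : Type) (r : seq I) (F : I -> int) :
  x != 0 -> \prod_(i <- r) x ^ F i = x ^ (\sum_(i <- r) F i).
Proof.
move=> x0; elim: r => [|i r IH]; first by rewrite !big_nil expr0z.
by rewrite !big_cons IH expfzDr.
Qed.

Lemma exprz_prod (K : fieldType) (m : int) (I : Type) (r : seq I) (F : I -> K) :
  (\prod_(i <- r) F i) ^ m = \prod_(i <- r) F i ^ m.
Proof.
elim: r => [|i r IH]; first by rewrite !big_nil exp1rz.
by rewrite !big_cons expfzMl IH.
Qed.

(** The exponents of coordinate [l] form column [l], so matrices multiply in the order in which the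
    maps are applied. Negative exponents add up only at nonzero coordinates. *)
Lemma mono_mul M N z : torus z -> mono N (mono M z) = mono (M *m N) z.
Proof.
move=> tz; apply: crdP => l; rewrite !monoE.
under eq_bigr => k _ do rewrite monoE exprz_prod.
rewrite exchange_big /=; apply: eq_bigr => j _.
under eq_bigr => k _ do rewrite exprz_exp.
by rewrite prodr_exprz // mxE.
Qed.

Lemma mono1 z : mono 1%:M z = z.
Proof.
apply: crdP => l; rewrite monoE (bigD1 l) //= mxE eqxx expr1z big1 ?mulr1 // => k kl.
by rewrite mxE (negbTE kl) expr0z.
Qed.

(** Test point at which [mono M] displays row [k] of [M] as exponents of 2, from which they can be
    recovered. *)
Definition two_at (k : 'I_n) : Cn R n := of_crd (fun l => if l == k then 2 else 1).

Lemma torus_two_at k : torus (two_at k).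
Proof. by move=> l; rewrite crd_of; case: ifP => _; [rewrite pnatr_eq0|exact: oner_neq0]. Qed.

Lemma mono_two_at M k l : crd (mono M (two_at k)) l = 2 ^ M k l.
Proof.
rewrite monoE (bigD1 k) //= crd_of eqxx big1 ?mulr1 // => j jk.
by rewrite crd_of (negbTE jk) exp1rz.
Qed.

Lemma exp2z_inj : injective (exprz (2 : R[i])).
Proof.
have E (m : int) : (2 : R[i]) ^ m = (2 ^ m)%:C by rewrite fmorphXz rmorph_nat.
move=> m k; rewrite !E => /complexI; apply: ieexprIz; rewrite ?ltr0n //.
by rewrite (eqr_nat _ 2 1).
Qed.

Lemma mono_inj M N : (forall z, torus z -> mono M z = mono N z) -> M = N.
Proof.
move=> h; apply/matrixP => k l; apply: exp2z_inj.
by rewrite -!mono_two_at h //; exact: torus_two_at.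
Qed.

End Monomials.

Section ToricCharts.
Variables (R : realType) (n : nat) (X : topologicalType) (A : set (chart R n X)).
Hypothesis atlasA : smooth_atlas A.
Variables (act : Cn R n -> X -> X) (J : forall p, tangent A p -> tangent A p).
Hypothesis actT : torus_action act.
Hypothesis acJ : almost_complex_structure J.
Hypothesis invJ : forall g, torus g -> invariant_under (act g) J.
Variable x0 : X.
Hypothesis openO : open (orbit_of act x0).
Hypothesis denseO : dense (orbit_of act x0).

Lemma open_dom_to (c : chart R n X) (V : set (Cn R n)) :
  open V -> open (dom c `&` to c @^-1` V).
Proof.
move=> oV; rewrite openE => x [cx Vx].
have n1 : nbhs x (dom c) by apply: open_nbhs_nbhs; split=> //; exact: dom_open.
have n2 : nbhs x (to c @^-1` V).
  by apply: (to_continuous cx); apply: open_nbhs_nbhs.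
exact: (@filterI _ (nbhs x) _ _ _ n1 n2).
Qed.

Section OneChart.
Variables (c : chart R n X) (chi : 'I_n -> Cn R n -> R[i]).
Hypothesis repc : representation_chart A act chi c.
Hypothesis chiP : forall k, smooth_character (chi k).

Let chart_from z : dom c (from c z) := rep_dom_from repc z.
Let chart_to_from z : to c (from c z) = z := rep_to_from repc z.

Definition chart_chi g : Cn R n := of_crd (fun k => chi k g).

Lemma chart_chi_hom : torus_hom chart_chi.
Proof.
split=> [g tg k|g g' tg tg']; first by rewrite crd_of; have [h _ _ _] := chiP k; exact: h.
by apply: crdP => k; rewrite crdM !crd_of; have [_ h _ _] := chiP k; exact: h.
Qed.

Lemma chart_act g x : torus g -> dom c x -> dom c (act g x) /\
  to c (act g x) = tmul (chart_chi g) (to c x).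
Proof.
case: repc => _ _ h1 h2 tg cx; split; first exact: h1.
by apply: crdP => k; rewrite h2 // crdM crd_of.
Qed.

Lemma actV g x : torus g -> act (tinv g) (act g x) = x.
Proof.
move=> tg; rewrite -actT.2 //; last exact: torusV.
by rewrite tmulV // actT.1.
Qed.

Lemma meets_orbit (V : set (Cn R n)) z : open V -> V z ->
  exists g, [/\ torus g, dom c (act g x0) & V (to c (act g x0))].
Proof.
move=> oV Vz.
have [|x [[cx Vx] [g tg gx]]] := denseO _ (open_dom_to c oV).
  by exists (from c z); split; [exact: chart_from|rewrite /preimage /= chart_to_from].
by exists g; rewrite gx.
Qed.

Lemma base_dom : dom c x0.
Proof.
have [g [tg cg _]] := meets_orbit openT (I : [set: Cn R n] 0).
by rewrite -(actV x0 tg); apply: (chart_act _ cg).1; exact: torusV.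
Qed.

(** A coordinate vanishing at [x0] would vanish along its whole orbit, which is dense and so meets
    the torus of the chart. *)
Lemma base_torus : torus (to c x0).
Proof.
have [g [tg _ h]] := meets_orbit (@open_torus R n) (@torus1 R n).
move=> k; move: (h k); rewrite (chart_act tg base_dom).2 crdM.
by apply: contraNneq => ->; rewrite mulr0.
Qed.

(** The orbit, read in the chart, and its translate by [t] are open, so by density they meet.
    Cancelling the base point writes [t] as a quotient of two values of [chart_chi]. *)
Lemma chart_chi_surj t : torus t -> exists2 g, torus g & chart_chi g = t.
Proof.
move=> tt; pose S := to c @` (dom c `&` orbit_of act x0).
have oS : open S by exact: open_image_to.
have oV : open (tmul (tinv t) @^-1` S).
  by apply: open_comp => // z _; exact: linear_Cn_continuous.
have Vz : (tmul (tinv t) @^-1` S) (tmul t (to c x0)).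
  rewrite /preimage /= tmulA tmulV // tmul1; exists x0 => //; split; first exact: base_dom.
  by exists (tone R n); [exact: torus1|exact: actT.1].
have [g [tg cg [_ [_ [g' tg' <-]]]]] := meets_orbit oV Vz.
rewrite (chart_act tg base_dom).2 (chart_act tg' base_dom).2 => e.
exists (tmul g (tinv g')); first by apply: torusM => //; exact: torusV.
have [hT hM] := chart_chi_hom.
have := e; rewrite tmulA (tmulC _ (to c x0)) (tmulC _ (to c x0)) => /(tmulI base_torus) e'.
rewrite hM //; last exact: torusV.
have := hT _ tg' => tc; apply: (tmulI tc).
rewrite (tmulC (chart_chi g)) tmulA -hM // ?(tmulC g') ?tmulV //; last exact: torusV.
rewrite (hom_tone chart_chi_hom) tmul1 e' -tmulA tmulC -tmulA (tmulC t) tmulV //.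
by rewrite tmulr1.
Qed.

End OneChart.

(** With [x0] at the point 1, [psi] is the orbit map of [x0] in coordinates. The clause on its
    kernel is weaker than injectivity, which comes from effectiveness in [toric_chart_faithful]. *)
Definition toric_chart (b : chart R n X) (psi : Cn R n -> Cn R n) : Prop :=
  [/\ smooth_chart A b /\
        (forall p (v : tangent A p), dom b p -> tcoord b (J v) = mulI (tcoord b v)),
      cod b = setT, dom b x0 /\ to b x0 = tone R n,
      [/\ torus_hom psi, differentiable psi (tone R n),
          forall t, torus t -> exists2 g, torus g & psi g = t &
          forall g, torus g -> psi g = tone R n -> act g x0 = x0] &
      forall g x, torus g -> dom b x ->
        dom b (act g x) /\ to b (act g x) = tmul (psi g) (to b x)].

Lemma rep_toric_chart c chi : representation_chart A act chi c ->
  (forall k, smooth_character (chi k)) ->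
  exists b psi, toric_chart b psi /\ dom b = dom c.
Proof.
move=> repc chiP; have [sc codc _ _] := repc.
have surj := chart_chi_surj repc chiP.
have [e he] : exists e : 'I_n -> bool,
  forall p (v : tangent A p), dom c p -> forall k,
    crd (tcoord c (J v)) k = (if e k then 'i else - 'i) * crd (tcoord c v) k.
  apply: (invariant_structure_diagonal atlasA acJ invJ repc).
  by move=> t /surj[g tg <-]; exists g => // k; rewrite crd_of.
have cx0 := base_dom repc; have tx0 := base_torus repc.
(* The coordinates of [x0] after conjugation; dividing by them puts [x0] at 1. *)
pose w : Cn R n := of_crd (fun k => cj (e k) (crd (to c x0) k)).
have tw : torus w by move=> k; rewrite crd_of cj_eq0.
have ti := torusV tw; set t := tinv w in ti.
pose b := lin_chart (cscaleK e ti) (cunscaleK e ti) c.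
pose psi g : Cn R n := of_crd (fun k => cj (e k) (chi k g)).
exists b, psi; split => //.
have [hT hM] := chart_chi_hom chiP.
have bE x : to b x = cscale e t (to c x) by [].
have psiE g k : crd (psi g) k = cj (e k) (crd (chart_chi chi g) k) by rewrite !crd_of.
split.
- split; first exact: lin_chart_smooth.
  move=> p v cp; rewrite (tcoord_lin atlasA) //.
  apply: etrans (congr1 (@mulI R n) (esym (tcoord_lin atlasA (cscaleK e ti) (cunscaleK e ti)
      v sc cp))).
  (* Conjugation turns the eigenvalue -i into i. *)
  apply: crdP => k; rewrite crdI !crd_of he // cjM [LHS]mulrCA; congr (_ * _).
  by case: (e k) => //=; congr (_ +i* _); rewrite ?oppr0 ?opprK.
- by rewrite -[cod b]/((cscale e t \o to c) @` dom c) (lin_codE (cscaleK e ti)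
    (cunscaleK e ti)) codc.
- split; first exact: cx0.
  rewrite bE; apply: crdP => k; rewrite crd1 crd_of crdV crd_of mulVf //.
  by move: (tw k); rewrite crd_of.
- split.
  + split=> [g tg k|g g' tg tg']; first by rewrite psiE cj_eq0; exact: hT.
    by apply: crdP => k; rewrite crdM !psiE hM // crdM cjM.
  + apply: differentiable_Cn => k; have [_ _ /(_ 1%N)[dR _] /(_ 1%N)[dI _]] := chiP k.
      have -> : (fun g => complex.Re (crd (psi g) k)) = (fun g => complex.Re (chi k g)).
        by apply/funext => g; rewrite crd_of; case: (e k); case: (chi k g).
      exact: (dR _ (@torus1 R n)).
    have : differentiable (fun g => complex.Im (chi k g)) (tone R n)
        by exact: (dI _ (@torus1 R n)).
    case E : (e k) => h.
      have -> // : (fun g => complex.Im (crd (psi g) k)) = (fun g => complex.Im (chi k g)).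
      by apply/funext => g; rewrite crd_of E.
    have := differentiableN h.
    congr (differentiable _ _); apply/funext => g.
    by rewrite crd_of E /= !fctE; case: (chi k g).
  + move=> s ts; pose s' : Cn R n := of_crd (fun k => cj (e k) (crd s k)).
    have ts' : torus s' by move=> k; rewrite crd_of cj_eq0.
    have [g tg gs] := surj _ ts'; exists g => //.
    by apply: crdP => k; rewrite psiE gs crd_of cjK.
  + move=> g tg /(congr1 (fun z => crd z)) pg.
    have cg : chart_chi chi g = tone R n.
      apply: crdP => k; apply: (can_inj (cjK (e k))).
      by rewrite -psiE pg !crd1; case: (e k) => //; exact/esym/conjc1.
    have [cgx e1] := chart_act repc tg cx0.
    by rewrite -(toK cgx) e1 cg tmul1 toK.
move=> g x tg cx; have [cgx e1] := chart_act repc tg cx; split => //.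
rewrite !bE e1; apply: crdP => k; rewrite [RHS]crdM psiE.
by rewrite !crd_of cjM mulrCA.
Qed.

End ToricCharts.

(** * Transitions between toric charts *)

Section MonomialTransition.
Variables (R : realType) (n : nat) (X : topologicalType) (A : set (chart R n X)).
Hypothesis atlasA : smooth_atlas A.
Variables (act : Cn R n -> X -> X) (J : forall p, tangent A p -> tangent A p).
Variable x0 : X.
Local Notation toric_chart := (toric_chart act J x0).

Lemma toric_chart_orbit b psi g : toric_chart b psi -> torus g ->
  dom b (act g x0) /\ to b (act g x0) = psi g.
Proof.
by case=> _ _ [bx b1] _ /(_ g x0) h tg; have [h1 h2] := h tg bx; rewrite h2 b1 tmulr1.
Qed.

(** The chart change carries [psi g] to [psi' g], so on the torus it is a homomorphism. Its
    differential at 1, the image of [x0], is complex linear, and [hom_mono] applies. *)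
Lemma toric_transition b psi b' psi' : toric_chart b psi -> toric_chart b' psi' ->
  exists M, forall g, torus g -> psi' g = mono M (psi g).
Proof.
move=> tb tb'; pose h := to b' \o from b.
have hE g : torus g -> h (psi g) = psi' g.
  move=> tg; have [d1 e1] := toric_chart_orbit tb tg.
  have [d2 e2] := toric_chart_orbit tb' tg.
  by rewrite /h /= -e1 toK.
have [[sb Jb] _ [bx b1] [[pT pM] _ surj _] _] := tb.
have [[sb' Jb'] _ [bx' b1'] [[pT' pM'] _ _ _] _] := tb'.
have hh : torus_hom h.
  split=> [z tz|z w tz tw].
    by have [g tg <-] := surj z tz; rewrite hE //; exact: pT'.
  have [g tg <-] := surj z tz; have [g' tg' <-] := surj w tw.
  have tgg := torusM tg tg'.
  by rewrite -pM // !hE // pM'.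
have := commuting_holomorphic atlasA sb sb' Jb Jb'.
case/(_ (tone R n)) => [|dh hI]; first by exists x0.
have [M hM] := hom_mono hh dh hI.
by exists M => g tg; rewrite -hE // hM //; exact: pT.
Qed.

Lemma toric_transition_unit b psi b' psi' M : toric_chart b psi -> toric_chart b' psi' ->
  (forall g, torus g -> psi' g = mono M (psi g)) -> M \in unitmx.
Proof.
move=> tb tb' hM; have [M' hM'] := toric_transition tb' tb.
have [_ _ _ [_ _ surj _] _] := tb.
suff /mulmx1_unit[] : M *m M' = 1%:M by [].
apply: (@mono_inj R) => z tz; have [g tg <-] := surj z tz.
rewrite mono1 -mono_mul; last by case: tb => _ _ _ [[pT _] _ _ _] _; exact: pT.
by rewrite -hM // -hM'.
Qed.

End MonomialTransition.

(** * Gluing of monomial charts and the fan *)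

Section RealOneParameterSubgroups.
Variables (R : realType) (n : nat).
Implicit Types (a : 'rV[R]_n) (w : Cn R n).

(** With s = - ln t this is t |-> t^a for t > 0. The weights are real because the fan has to fill
    R^n, and s to infinity is the usual limit t to 0. *)
Definition opsg a (s : R) : Cn R n := of_crd (fun k => (expR (- s * a 0 k))%:C).
Definition zero_locus a : Cn R n := of_crd (fun k => if a 0 k == 0 then 1 else 0).

Lemma torus_opsg a s : torus (opsg a s).
Proof.
move=> k; rewrite crd_of; apply/eqP => -[e].
by have := expR_gt0 (- s * a 0 k); rewrite e ltxx.
Qed.

Lemma expR_intz (x : R) (m : int) : expR x ^ m = expR (x * m%:~R).
Proof.
case: m => m; first by rewrite -exprnP -expRM_natr.
by rewrite NegzE -exprnN mulrNz mulrN expRN -pmulrn expRM_natr.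
Qed.

Lemma mono_opsg (M : 'M[int]_n) a s : mono M (opsg a s) = opsg (a *m map_mx intr M) s.
Proof.
apply: crdP => l; rewrite monoE crd_of mxE.
under eq_bigr => k _ do rewrite crd_of -fmorphXz expR_intz.
rewrite -rmorph_prod; congr (_%:C).
rewrite -(big_morph (@expR R) (@expRD R) (expR0 R)); congr expR.
by rewrite mulr_sumr; apply: eq_bigr => k _; rewrite mxE mulrA.
Qed.

Lemma cvg_opsg a w : (forall k, 0 <= a 0 k) ->
  tmul w (opsg a s) @[s --> +oo] --> tmul w (zero_locus a).
Proof.
move=> a0.
have E k : expR (- s * a 0 k) @[s --> +oo] --> (if a 0 k == 0 then 1 else 0 : R).
  have [->|ak] := eqVneq (a 0 k) 0.
    by under eq_cvg do rewrite mulr0 expR0; exact: cvg_cst.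
  have ap : 0 < a 0 k by rewrite lt_neqAle eq_sym ak a0.
  have h : s * a 0 k @[s --> +oo] --> +oo.
    apply/cvgryPge => B; near=> s.
    by rewrite -ler_pdivrMr //; near: s; apply: nbhs_pinfty_ge; rewrite num_real.
  under eq_cvg do rewrite mulNr.
  exact: (cvg_comp _ _ h (@cvgr_expR R)).
have ReM z (r : R) : complex.Re (z * r%:C) = complex.Re z * r.
  by case: z => x y /=; rewrite mulr0 subr0.
have ImM z (r : R) : complex.Im (z * r%:C) = complex.Im z * r.
  by case: z => x y /=; rewrite mulr0 add0r.
have crdL k : crd (tmul w (zero_locus a)) k = crd w k * (if a 0 k == 0 then 1 else 0 : R)%:C.
  by rewrite crdM crd_of; case: ifP.
have crdS k s : crd (tmul w (opsg a s)) k = crd w k * (expR (- s * a 0 k))%:C.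
  by rewrite crdM crd_of.
apply: cvg_Cn => k.
  under eq_cvg do rewrite crdS ReM.
  by rewrite crdL ReM; apply: cvgM; [exact: cvg_cst|exact: E].
under eq_cvg do rewrite crdS ImM.
by rewrite crdL ImM; apply: cvgM; [exact: cvg_cst|exact: E].
Unshelve. all: by end_near. Qed.

(** A negative weight makes its coordinate grow beyond all bounds, by exp x >= 1 + x, so the curve
    leaves a neighbourhood of [w] for good. *)
Lemma cluster_opsg a w : cluster (opsg a s @[s --> +oo]) w -> forall k, 0 <= a 0 k.
Proof.
move=> cw k; rewrite leNgt; apply/negP => ak.
pose B := [set z : Cn R n | complex.Re (crd z k) < complex.Re (crd w k) + 1].
have nB : nbhs w B.
  by apply: (cvgr_lt _ (@continuous_Re R n k w)); rewrite ltrDl.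
pose S := [set z : Cn R n | complex.Re (crd w k) + 1 <= complex.Re (crd z k)].
have FS : \forall s \near +oo, S (opsg a s).
  have : \forall s \near +oo, complex.Re (crd w k) / - a 0 k <= s.
    by apply: nbhs_pinfty_ge; exact: num_real.
  apply: filterS => s hs.
  suff : complex.Re (crd w k) + 1 <= complex.Re (crd (opsg a s) k) by [].
  rewrite crd_of; apply: (le_trans _ (expR_ge1Dx (- s * a 0 k))).
  by rewrite mulNr -mulrN addrC lerD2l -ler_pdivrMr ?oppr_gt0.
have [z [Sz Bz]] := cw _ _ FS nB.
by move: (le_lt_trans Sz Bz); rewrite ltxx.
Qed.

End RealOneParameterSubgroups.

Section Gluing.
Variables (R : realType) (n : nat) (X : topologicalType).
Hypothesis hausX : hausdorff_space X.
Variables (act : Cn R n -> X -> X) (x0 : X).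

Definition monomial_chart (b : chart R n X) (M : 'M[int]_n) : Prop :=
  [/\ cod b = setT, dom b x0 /\ to b x0 = tone R n, M \in unitmx &
      forall g x, torus g -> dom b x ->
        dom b (act g x) /\ to b (act g x) = tmul (mono M g) (to b x)].

Lemma mchart_from b M z : monomial_chart b M -> dom b (from b z) /\ to b (from b z) = z.
Proof. by case=> e _ _ _; rewrite to_from ?e //; split=> //; apply: dom_from; rewrite e. Qed.

Lemma mchart_cvg b M z (P : R -> Cn R n) : monomial_chart b M ->
  P s @[s --> +oo] --> z -> from b (P s) @[s --> +oo] --> from b z.
Proof.
case=> e _ _ _ Pz.
have cz : cod b z by rewrite e.
exact: (cvg_comp _ _ Pz (from_continuous cz)).
Qed.

Lemma mchart_orbit b M g : monomial_chart b M -> torus g ->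
  dom b (act g x0) /\ to b (act g x0) = mono M g.
Proof. by case=> _ [d0 e0] _ h tg; have := h g x0 tg d0; rewrite e0 tmulr1. Qed.

Lemma mono_invK (M : 'M[int]_n) (z : Cn R n) : M \in unitmx -> torus z ->
  mono M (mono (invmx M) z) = z.
Proof. by move=> uM tz; rewrite mono_mul // mulVmx // mono1. Qed.

Section TwoCharts.
Variables (b b' : chart R n X) (M M' : 'M[int]_n).
Hypotheses (cb : monomial_chart b M) (cb' : monomial_chart b' M').
Let N := invmx M *m M'.

Lemma from_torus z : torus z -> dom b' (from b z) /\ to b' (from b z) = mono N z.
Proof.
move=> tz; have uM : M \in unitmx by case: cb.
have tg := torus_mono (invmx M) tz.
have [d1 e1] := mchart_orbit cb tg; have [d2 e2] := mchart_orbit cb' tg.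
by rewrite -{1 2}(mono_invK uM tz) -e1 toK // e2 mono_mul.
Qed.

(* Approach [z] inside the torus: the limits of one curve taken in both charts agree
   by the Hausdorff property. *)
Lemma glue z : (forall k, crd z k = 0 -> forall l, 0 <= N k l) ->
  dom b' (from b z) /\ to b' (from b z) = mono N z.
Proof.
move=> N0.
(* [a] marks the vanishing coordinates of [z], and [z'] replaces them by 1: the curve from [z'] with
   weights [a] stays in the torus and tends to [z]. *)
pose a : 'rV[R]_n := \row_k (crd z k == 0)%:R.
pose z' : Cn R n := of_crd (fun k => if crd z k == 0 then 1 else crd z k).
have z'E k : crd z' k = if crd z k == 0 then 1 else crd z k by exact: crd_of.
clearbody z'.
have tz' : torus z'.
  by move=> k; rewrite z'E; case: ifP => [_|->//]; exact: oner_neq0.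
have a0 k : 0 <= a 0 k by rewrite mxE ler0n.
pose aN := a *m map_mx intr N.
have aNE l : aN 0 l = \sum_(k | crd z k == 0) (N k l)%:~R.
  rewrite mxE [RHS]big_mkcond; apply: eq_bigr => k _; rewrite !mxE.
  by case: eqP => _; rewrite ?mul1r ?mul0r.
have aN0 l : 0 <= aN 0 l.
  by rewrite aNE; apply: sumr_ge0 => k /eqP zk; rewrite ler0z; exact: N0.
have zE : tmul z' (zero_locus a) = z.
  apply: crdP => k; rewrite crdM z'E crd_of mxE.
  by case: (eqVneq (crd z k) 0) => [->|_]; rewrite ?oner_eq0 ?eqxx ?mulr0 ?mulr1.
pose w := tmul (mono N z') (zero_locus aN).
have c1 : from b (tmul z' (opsg a s)) @[s --> +oo] --> from b z.
  by apply: (mchart_cvg cb); rewrite -[X in _ --> X]zE; exact: cvg_opsg.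
have c2 : from b (tmul z' (opsg a s)) @[s --> +oo] --> from b' w.
  have E s : from b (tmul z' (opsg a s)) = from b' (tmul (mono N z') (opsg aN s)).
    have [d e] := from_torus (torusM tz' (torus_opsg a s)).
    by rewrite -[LHS](toK d) e mono_tmul mono_opsg.
  under eq_cvg do rewrite E.
  by apply: (mchart_cvg cb'); exact: cvg_opsg.
have -> := cvg_unique hausX c1 c2.
have [d e] := mchart_from w cb'; split => //; rewrite e.
apply: crdP => l; rewrite crdM !monoE crd_of.
(* Weight 0 means that no vanishing coordinate of [z] occurs in the [l]-th monomial, so [z'] and [z]
   give the same value; otherwise both sides vanish. *)
have [e0|e0] := eqVneq (aN 0 l) 0.
  rewrite mulr1; apply: eq_bigr => k _; rewrite z'E.
  have [zk|_] := eqVneq (crd z k) 0; last by [].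
  suff -> : N k l = 0 by rewrite !expr0z.
  have := e0; rewrite aNE => /eqP; rewrite psumr_eq0; last first.
    by move=> j /eqP zj; rewrite ler0z; exact: N0.
  move=> /allP/(_ k (mem_index_enum k)); rewrite zk eqxx /= intr_eq0 => /eqP.
  exact.
rewrite mulr0.
have [k zk Nk] : exists2 k, crd z k == 0 & N k l != 0.
  apply/exists_inP; apply: contra_neqT e0 => /exists_inPn h.
  by rewrite aNE big1 // => k /h /negPn/eqP ->.
by rewrite (bigD1 k) //= (eqP zk) exp0rz (negbTE Nk) mul0r.
Qed.

End TwoCharts.

(** A generic point of the divisor where the [k]-th coordinate vanishes. *)
Definition puncture (k : 'I_n) : Cn R n := of_crd (fun j => if j == k then 0 else 1).

(* Perturbing the vanishing coordinates of [x] other than [k] keeps it in the open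
   set [dom b']; the torus then moves it to [puncture k]. *)
Lemma puncture_dom b b' M M' x k : monomial_chart b M -> monomial_chart b' M' ->
  dom b x -> dom b' x -> crd (to b x) k = 0 -> dom b' (from b (puncture k)).
Proof.
move=> cb cb' bx bx' xk; set z := to b x.
pose c j := (crd z j == 0) && (j != k).
pose a : 'rV[R]_n := \row_j (c j)%:R.
pose z'' : Cn R n := of_crd (fun j => if c j then 1 else crd z j).
have a0 j : 0 <= a 0 j by rewrite mxE ler0n.
have zE : tmul z'' (zero_locus a) = z.
  apply: crdP => j; rewrite crdM !crd_of mxE.
  case E : (c j); rewrite ?oner_eq0 ?eqxx ?mulr0 ?mulr1 //.
  by move: E => /andP[/eqP-> _].
have [s [_ bs]] : exists s, cod b (tmul z'' (opsg a s)) /\ dom b' (from b (tmul z'' (opsg a s))).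
  have nU := near_to (dom_open b') bx bx'.
  have cz := cvg_opsg (w := z'') a0; rewrite zE in cz.
  have H : \forall s \near +oo, cod b (tmul z'' (opsg a s)) /\
      dom b' (from b (tmul z'' (opsg a s))) by exact: (cz _ nU).
  by have [s Hs] := @filter_ex _ _ _ _ H; exists s.
set y := tmul z'' (opsg a s) in bs.
have yk : crd y k = 0 by rewrite crdM crd_of /c eqxx andbF /z xk mul0r.
have ynk j : j != k -> crd y j != 0.
  move=> jk; rewrite crdM mulf_neq0 ?torus_opsg // crd_of.
  case E : (c j); first exact: oner_neq0.
  by move: E; rewrite /c jk andbT => ->.
clearbody y.
pose t : Cn R n := of_crd (fun j => if j == k then 1 else (crd y j)^-1).
have tt : torus t.
  move=> j; rewrite crd_of; case: ifPn => [_|jk]; first exact: oner_neq0.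
  by rewrite invr_eq0 ynk.
have ty : tmul t y = puncture k.
  apply: crdP => j; rewrite crdM !crd_of; case: ifPn => [/eqP->|jk].
    by rewrite yk mulr0.
  by rewrite mulVf // ynk.
have [dy ey] := mchart_from y cb.
have [_ _ uM h] := cb; have [_ _ _ h'] := cb'.
have tg := torus_mono (invmx M) tt.
have [d1 e1] := h _ _ tg dy; have [d2 _] := h' _ _ tg bs.
by rewrite -ty -{1}ey -{1}(mono_invK uM tt) -e1 toK.
Qed.

(* The one-parameter subgroup of row [k] of [M^-1] converges in [b'], so row [k] of
   [N] is nonnegative; if [N k l > 0], the [l]-th coordinate subgroup of [b'] fixes
   the limit point, whose stabilizer in [b] only moves the coordinate [k]. *)
Lemma face b b' M M' x k : monomial_chart b M -> monomial_chart b' M' ->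
  dom b x -> dom b' x -> crd (to b x) k = 0 ->
  exists l, forall j, (invmx M *m M') k j = (j == l)%:R.
Proof.
move=> cb cb' bx bx' xk; set N := invmx M *m M'.
have dp := puncture_dom cb cb' bx bx' xk.
have [uM uM'] : M \in unitmx /\ M' \in unitmx by split; [case: cb|case: cb'].
pose N' := invmx M' *m M.
have NN' : N *m N' = 1%:M.
  by rewrite mulmxA -(mulmxA (invmx M)) mulmxV // mulmx1 mulVmx.
have N'N : N' *m N = 1%:M.
  by rewrite mulmxA -(mulmxA (invmx M')) mulmxV // mulmx1 mulVmx.
pose ek : 'rV[R]_n := \row_j (j == k)%:R.
have ek0 j : 0 <= ek 0 j by rewrite mxE ler0n.
set p := puncture k in dp.
have pE : tmul (tone R n) (zero_locus ek) = p.
  apply: crdP => j; rewrite crdM crd1 mul1r !crd_of mxE.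
  by case: (j == k); rewrite ?oner_eq0 ?eqxx.
pose eN := ek *m map_mx intr N.
have eNE l : eN 0 l = (N k l)%:~R.
  rewrite mxE (bigD1 k) //= [ek 0 k]mxE eqxx mul1r [map_mx _ _ k l]mxE big1 ?addr0 // => j jk.
  by rewrite [ek 0 j]mxE (negbTE jk) mul0r.
have c1 : opsg eN s @[s --> +oo] --> to b' (from b p).
  have E s : opsg eN s = to b' (from b (tmul (tone R n) (opsg ek s))).
    have [_ ->] := from_torus cb cb' (torusM (@torus1 R n) (torus_opsg ek s)).
    by rewrite tmul1 mono_opsg.
  under eq_cvg do rewrite E.
  have c2 : from b (tmul (tone R n) (opsg ek s)) @[s --> +oo] --> from b p.
    by apply: (mchart_cvg cb); rewrite -pE; exact: cvg_opsg.
  exact: (cvg_comp _ _ c2 (to_continuous dp)).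
have eN0 l : 0 <= eN 0 l.
  apply: (@cluster_opsg _ _ _ (to b' (from b p))).
  move=> S V FS nV.
  have H : \forall s \near +oo, S (opsg eN s) /\ V (opsg eN s).
    exact: (filterI FS (c1 _ nV)).
  by have [s [Ss Vs]] := @filter_ex _ _ _ _ H; exists (opsg eN s).
have wE : to b' (from b p) = zero_locus eN.
  have := cvg_opsg (w := tone R n) eN0; rewrite tmul1; under eq_cvg do rewrite tmul1.
  by move=> c2; apply: (cvg_unique _ c1 c2); exact: norm_hausdorff.
have [l Nl] : exists l, N k l != 0.
  apply/existsP; apply: contraT => /existsPn h.
  have := congr1 (fun Q : 'M[int]_n => Q k k) NN'; rewrite [LHS]mxE [RHS]mxE eqxx big1 //.
  by move=> j _; rewrite (eqP (negPn (h j))) mul0r.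
have Nl0 : 0 < N k l.
  by rewrite lt_neqAle eq_sym Nl -(ler0z R) -eNE eN0.
have wl : crd (to b' (from b p)) l = 0.
  by rewrite wE crd_of eNE intr_eq0 (negbTE Nl).
have tg := torus_mono (invmx M') (@torus_two_at R n l).
have [_ _ _ h] := cb; have [_ _ _ h'] := cb'.
have fx : act (mono (invmx M') (two_at R l)) (from b p) = from b p.
  have [d e] := h' _ _ tg dp.
  rewrite -[LHS](toK d) e mono_invK //; last exact: torus_two_at.
  rewrite -[RHS](toK dp); congr from.
  apply: crdP => j; rewrite crdM crd_of; case: eqP => [->|_]; last by rewrite mul1r.
  by rewrite wl mulr0.
have N'0 j : j != k -> N' l j = 0.
  move=> jk; have [dfp efp] := mchart_from p cb.
  have [_] := h _ _ tg dfp; rewrite fx efp mono_mul; last exact: torus_two_at.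
  move=> /(congr1 (fun z => crd z j)); rewrite crdM mono_two_at crd_of (negbTE jk).
  by rewrite mulr1 => e; apply: (@exp2z_inj R); rewrite expr0z.
(* Row [l] of [N'] is supported at [k], so row [l] of the identity is a multiple of row [k] of [N].
   The factor is an integer and [N k l] is positive, hence both are 1. *)
have N'k j : N' l k * N k j = (l == j)%:R.
  have := congr1 (fun Q : 'M[int]_n => Q l j) N'N; rewrite [LHS]mxE [RHS]mxE (bigD1 k) //=
      big1 ?addr0 // => i ik.
  by rewrite N'0 // mul0r.
have Nl1 : N k l = 1.
  have := N'k l; rewrite eqxx => e.
  have /eqP := congr1 absz e; rewrite abszM muln_eq1 => /andP[_ /eqP h1].
  by rewrite -(gtz0_abs Nl0) h1.
have N'1 : N' l k = 1 by have := N'k l; rewrite eqxx Nl1 mulr1.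
by exists l => j; have := N'k j; rewrite N'1 mul1r eq_sym.
Qed.

End Gluing.

Section PermutedCoordinates.
Variables (R : realType) (n : nat).

Definition perm_crd (s : 'S_n) (z : Cn R n) : Cn R n := of_crd (fun k => crd z (s k)).

Lemma perm_crd_is_linear s : linear (perm_crd s).
Proof. by move=> a u v; apply: crdP => k; rewrite crdD crdZ !crd_of crdD crdZ. Qed.
HB.instance Definition _ s :=
  GRing.isLinear.Build R (Cn R n) (Cn R n) _ (perm_crd s) (perm_crd_is_linear s).

Lemma perm_crdK s : cancel (perm_crd s) (perm_crd s^-1%g).
Proof. by move=> z; apply: crdP => k; rewrite !crd_of permKV. Qed.

Lemma perm_crdVK s : cancel (perm_crd s^-1%g) (perm_crd s).
Proof. by move=> z; apply: crdP => k; rewrite !crd_of permK. Qed.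

(** [max_cone] admits every enumeration of the rays of a cone, so each chart has to be supplied in
    every order of its coordinates. *)
Definition perm_chart (X : topologicalType) s (b : chart R n X) :=
  lin_chart (@perm_crdK s) (@perm_crdVK s) b.

Lemma perm_monomial_chart (X : topologicalType) (act : Cn R n -> X -> X) x0 b M s :
  monomial_chart act x0 b M -> monomial_chart act x0 (perm_chart s b) (col_perm s M).
Proof.
case=> e [d0 e0] uM h.
have toE y : to (perm_chart s b) y = perm_crd s (to b y) by [].
split.
- by rewrite -[cod _]/((perm_crd s \o to b) @` dom b)
    (lin_codE (@perm_crdK s) (@perm_crdVK s)) e.
- split; first exact: d0.
  rewrite toE e0.
  by apply: crdP => k; rewrite crd_of !crd1.
- by rewrite col_permE unitmx_mul uM unitmx_perm.
move=> g x tg bx; have [d1 e1] := h g x tg bx; split; first exact: d1.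
rewrite !toE e1.
apply: crdP => k; rewrite crd_of [RHS]crdM crdM crd_of; congr (_ * _).
by rewrite !monoE; apply: eq_bigr => j _; rewrite mxE.
Qed.

End PermutedCoordinates.

Lemma row_delta n (Q : 'M[int]_n) k l :
  (forall j, Q k j = (j == l)%:R) <-> row k Q = delta_mx 0 l.
Proof.
split=> [h|/rowP h j]; first by apply/rowP => j; rewrite !mxE h eqxx.
by have := h j; rewrite !mxE eqxx.
Qed.

(** * The fan of the charts and its toric variety *)

Section Fan.
Variables (R : realType) (n : nat) (X : topologicalType).
Hypotheses (hausX : hausdorff_space X) (compX : compact [set: X]).
Variables (act : Cn R n -> X -> X) (x0 : X).
Variables (N : nat) (b : 'I_N -> chart R n X) (M : 'I_N -> 'M[int]_n).
Hypothesis mb : forall i, monomial_chart act x0 (b i) (M i).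
Hypothesis cover : forall x, exists i, dom (b i) x.

Let M_unit i : M i \in unitmx. Proof. by case: (mb i). Qed.

(* Row [k] of [(M i)^-1] is the one-parameter subgroup which acts in the chart [b i]
   on the [k]-th coordinate alone. *)
Definition ray_seq : seq 'rV[int]_n :=
  undup [seq row p.2 (invmx (M p.1)) | p <- enum {: 'I_N * 'I_n}].
Definition ray (j : 'I_(size ray_seq)) : 'rV[int]_n := nth 0 ray_seq j.

Lemma mem_ray_seq i k : row k (invmx (M i)) \in ray_seq.
Proof. by rewrite mem_undup; apply/mapP; exists (i, k); rewrite ?mem_enum. Qed.

Lemma ray_index_lt i k : (index (row k (invmx (M i))) ray_seq < size ray_seq)%N.
Proof. by rewrite index_mem mem_ray_seq. Qed.

Definition chart_rays i : {ffun 'I_n -> 'I_(size ray_seq)} :=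
  [ffun k => Ordinal (ray_index_lt i k)].

Lemma ray_chart i k : ray (chart_rays i k) = row k (invmx (M i)).
Proof. by rewrite /ray ffunE /= nth_index // mem_ray_seq. Qed.

Lemma ray_inj : injective ray.
Proof.
move=> j j' /eqP; rewrite nth_uniq ?ltn_ord ?undup_uniq // => /eqP.
exact: val_inj.
Qed.

Lemma rayP j : exists i k, ray j = row k (invmx (M i)).
Proof.
have : ray j \in ray_seq by exact: mem_nth.
by rewrite mem_undup => /mapP[[i k] _ ->]; exists i, k.
Qed.

Lemma row_mulK i k : row k (invmx (M i)) *m M i = delta_mx 0 k.
Proof. by rewrite -row_mul mulVmx // row1. Qed.

Lemma chart_rays_inj i : injective (chart_rays i).
Proof.
move=> k k' /(congr1 ray); rewrite !ray_chart => /(congr1 (mulmx^~ (M i))).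
rewrite !row_mulK => /rowP/(_ k'); rewrite !mxE !eqxx /=.
by case: eqP => // ->.
Qed.

Definition chart_cones : {set {set 'I_(size ray_seq)}} :=
  finset (fun I : {set 'I_(size ray_seq)} => [exists i, I \subset rays (chart_rays i)]).

Lemma chart_conesP (I : {set 'I_(size ray_seq)}) : reflect (exists i,
    I \subset rays (chart_rays i)) (I \in chart_cones).
Proof. by rewrite inE; exact: existsP. Qed.

Lemma sum_rays (V : nmodType) i (I : {set 'I_(size ray_seq)}) (F : 'I_(size ray_seq) -> V) :
  I \subset rays (chart_rays i) ->
  \sum_(j in I) F j = \sum_(k | chart_rays i k \in I) F (chart_rays i k).
Proof.
move=> sI; have -> : I = [set chart_rays i k | k in finset (fun k => chart_rays i k \in I)]%SET.
  apply/setP => j; apply/idP/imsetP => [jI|[k]]; last by rewrite inE => ? ->.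
  have /imsetP[k _ jk] := fintype.subsetP sI j jI.
  by exists k; rewrite // inE -jk.
rewrite big_imset; last by move=> k k' _ _; exact: chart_rays_inj.
apply: eq_bigl => k; rewrite inE; apply/idP/imsetP => [kI|[k' + /chart_rays_inj ->]].
  by exists k => //; rewrite inE.
by rewrite inE.
Qed.

(** Coordinates of [x] in the basis of rays of the chart [i], as these are the rows of the inverse
    of [M i]. *)
Local Notation coord i x := (x *m map_mx intr (M i)).

Lemma coord_cone i (I : {set 'I_(size ray_seq)}) (a : 'I_(size ray_seq) -> R)
    k : I \subset rays (chart_rays i) ->
  (coord i (\sum_(j in I) a j *: map_mx intr (ray j))) 0 k =
  if chart_rays i k \in I then a (chart_rays i k) else 0.
Proof.
move=> sI; rewrite (sum_rays _ sI) mulmx_suml summxE.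
have E k' : ((a (chart_rays i k') *: map_mx intr (ray (chart_rays i k'))) *m map_mx intr (M i))
    0 k
    = if k' == k then a (chart_rays i k) else 0.
  rewrite ray_chart -scalemxAl -map_mxM row_mulK mxE [X in _ * X]mxE mxE eqxx /=.
  rewrite (eq_sym k); case: eqP => [->|_]; first by rewrite mulr1.
  by rewrite mulr0.
under eq_bigr => k' _ do rewrite E.
rewrite -big_mkcondr; case: ifPn => kI.
  rewrite (big_pred1 k) // => k' /=.
  by case: (eqVneq k' k) => [->|_]; rewrite ?kI ?andbF.
rewrite big_pred0 // => k'.
by case: (eqVneq k' k) => [->|_]; rewrite ?(negbTE kI) ?andbF.
Qed.

Lemma coordK i (x : 'rV[R]_n) : coord i x *m map_mx intr (invmx (M i)) = x.
Proof. by rewrite -mulmxA -map_mxM mulmxV // map_mx1 mulmx1. Qed.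

Lemma cone_coord i (x : 'rV[R]_n) : (forall k, 0 <= coord i x 0 k) ->
  cone (R := R) ray (rays (chart_rays i)) x.
Proof.
move=> x0'.
pose a j : R := \sum_(k | chart_rays i k == j) coord i x 0 k.
exists a; split=> [j|]; first by apply: sumr_ge0.
rewrite (@sum_rays _ i) // -[LHS](coordK i) mulmx_sum_row.
rewrite [RHS](eq_bigl predT); last by move=> k; apply/imsetP; exists k.
apply: eq_bigr => k _; rewrite ray_chart map_row; congr (_ *: _).
by rewrite /a (big_pred1 k) // => k'; rewrite (inj_eq (@chart_rays_inj i)).
Qed.

Definition orbit_curve (x : 'rV[R]_n) (s : R) : X := act (opsg x s) x0.

Lemma to_orbit_curve i x s :
  dom (b i) (orbit_curve x s) /\ to (b i) (orbit_curve x s) = opsg (coord i x) s.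
Proof.
have [d e] := mchart_orbit (mb i) (torus_opsg x s).
by split => //; rewrite /orbit_curve e mono_opsg.
Qed.

Lemma cvg_orbit_curve i x : (forall k, 0 <= coord i x 0 k) ->
  orbit_curve x s @[s --> +oo] --> from (b i) (zero_locus (coord i x)).
Proof.
move=> x0'.
have E s : orbit_curve x s = from (b i) (tmul (tone R n) (opsg (coord i x) s)).
  by have [d e] := to_orbit_curve i x s; rewrite tmul1 -e toK.
under eq_cvg do rewrite E.
apply: (mchart_cvg (mb i)); rewrite -[X in _ --> X]tmul1; exact: cvg_opsg.
Qed.

Lemma cone_sub (I I' : {set 'I_(size ray_seq)}) : I' \subset I ->
  cone (R := R) ray I' `<=` cone (R := R) ray I.
Proof.
move=> sI x [a [a0 ->]]; exists (fun j => if j \in I' then a j else 0); split.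
  by move=> j; case: ifP.
rewrite [RHS](big_setID I') /= (finset.setIidPr sI) [X in _ + X]big1 ?addr0.
  by apply: eq_bigr => j ->.
by move=> j; rewrite inE => /andP[/negbTE-> _]; rewrite scale0r.
Qed.

(** By compactness the curve of [x] clusters at some [y]. In a chart around [y] its coordinates
    cluster too, which by [cluster_opsg] rules out negative weights. *)
Lemma cones_cover (x : 'rV[R]_n) : exists i, forall k, 0 <= coord i x 0 k.
Proof.
have [y [_ cy]] : [set: X] `&` cluster (orbit_curve x s @[s --> +oo]) !=set0.
  exact: (@compX (orbit_curve x s @[s --> +oo]) _ filterT).
have [i iy] := cover y; exists i.
apply: (@cluster_opsg _ _ _ (to (b i) y)) => S V FS nV.
have nV' : nbhs y (to (b i) @^-1` V) by exact: (to_continuous iy).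
have FS' : \forall s \near +oo, S (to (b i) (orbit_curve x s)).
  have : \forall s \near +oo, S (opsg (coord i x) s) by exact: FS.
  apply: filterS => s Ss.
  by have [_ ->] := to_orbit_curve i x s.
have [y' [Sy Vy]] := cy _ _ (FS' : (orbit_curve x s @[s --> +oo]) (to (b i) @^-1` S)) nV'.
by exists (to (b i) y').
Qed.

(** The curve of [x] has a limit in both charts, a single point by the Hausdorff property. A ray
    with nonzero coefficient in [I] is a vanishing coordinate of this point; by [face] and [glue] it
    matches a vanishing coordinate in the other chart, hence a ray of [I']. *)
Lemma cone_inter (I I' : {set 'I_(size ray_seq)}) : I \in chart_cones -> I' \in chart_cones ->
  cone (R := R) ray I `&` cone (R := R) ray I' `<=` cone (R := R) ray (I :&: I').
Proof.
move=> /chart_conesP[i sI] /chart_conesP[i' sI'] x [[a [a0 xa]] [a' [a0' xa']]].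
have cE k : coord i x 0 k = if chart_rays i k \in I then a (chart_rays i k) else 0.
  by rewrite xa coord_cone.
have cE' k : coord i' x 0 k = if chart_rays i' k \in I' then a' (chart_rays i' k) else 0.
  by rewrite xa' coord_cone.
have c0 k : 0 <= coord i x 0 k by rewrite cE; case: ifP.
have c0' k : 0 <= coord i' x 0 k by rewrite cE'; case: ifP.
set z := zero_locus (coord i x); set z' := zero_locus (coord i' x).
have zz' : from (b i) z = from (b i') z'.
  exact: (cvg_unique hausX (cvg_orbit_curve c0) (cvg_orbit_curve c0')).
have [d e] := mchart_from z (mb i); have [d' e'] := mchart_from z' (mb i').
rewrite -zz' in d' e'.
have fc k : crd z k = 0 -> exists l, forall j, (invmx (M i) *m M i') k j = (j == l)%:R.
  by move=> zk; apply: (face (mb i) (mb i') d d'); rewrite e.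
have [_ e2] : dom (b i') (from (b i) z) /\ to (b i') (from (b i) z) = mono (invmx (M i)
    *m M i') z.
  by apply: (glue hausX (mb i) (mb i')) => k /fc[l hl] j; rewrite hl ler0n.
have incl j : j \in I -> a j != 0 -> j \in I'.
  move=> jI aj; have /imsetP[k _ jk] := fintype.subsetP sI j jI.
  have zk : crd z k = 0 by rewrite crd_of cE -jk jI (negbTE aj).
  have [l hl] := fc k zk.
  have jl : j = chart_rays i' l.
    apply: ray_inj; rewrite jk !ray_chart.
    have -> : row k (invmx (M i)) = row k (invmx (M i) *m M i') *m invmx (M i').
      by rewrite -row_mul -mulmxA mulmxV // mulmx1.
    by move/row_delta: hl => ->; rewrite -rowE.
  have z'l : crd z' l = 0.
    rewrite -e' e2 monoE (bigD1 k) //= zk hl eqxx expr1z mul0r //.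
  have : coord i' x 0 l != 0.
    by move: z'l; rewrite crd_of; case: eqP => // _ /eqP; rewrite oner_eq0.
  by rewrite cE' -jl; case: ifP => // _; rewrite eqxx.
exists a; split => //; rewrite xa [LHS](big_setID I') /= [X in _ + X]big1 ?addr0 // => j.
rewrite inE => /andP[jI' jI]; case: (eqVneq (a j) 0) => [->|aj]; first by rewrite scale0r.
by rewrite (incl j jI aj) in jI'.
Qed.

Lemma chart_fan : nonsingular_complete_fan R ray chart_cones.
Proof.
split.
- move=> I I' /chart_conesP[i sI] sI'; apply/chart_conesP; exists i.
  exact: fintype.subset_trans sI' sI.
- move=> I /chart_conesP[i sI].
  have /choice[r hr] : forall j, exists k : 'I_n, j \in I -> ray j = row k (invmx (M i)).
    (* Outside [I] the value of [r] is arbitrary; [rayP] shows that there is one. *)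
    move=> j; have [jI|jI] := boolP (j \in I); last by have [i' [k _]] := rayP j; exists k.
    by have /imsetP[k _ ->] := fintype.subsetP sI j jI; exists k => _; exact: ray_chart.
  exists (invmx (M i)), r; split; first by rewrite unitmx_inv.
    by move=> j j' jI jI' e; apply: ray_inj; rewrite !hr // e.
  by move=> j jI; rewrite hr.
- move=> I I' IK IK'; apply/seteqP; split; first exact: cone_inter.
  by move=> x cx; split; apply: cone_sub cx; [exact: finset.subsetIl|exact: finset.subsetIr].
apply/seteqP; split=> // x _; have [i hi] := cones_cover x.
exists (rays (chart_rays i)); last exact: cone_coord.
by apply/chart_conesP; exists i.
Qed.

Lemma chart_max_cone i : max_cone chart_cones (chart_rays i).
Proof. by split; [exact: chart_rays_inj|apply/chart_conesP; exists i]. Qed.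

(** An injective enumeration of [n] among the [n] rays of a chart takes all of them, in some
    order. *)
Lemma max_coneP e : max_cone chart_cones e ->
  exists i (s : 'S_n), forall k, e k = chart_rays i (s k).
Proof.
move=> [injE /chart_conesP[i sI]].
have /choice[f hf] : forall k, exists l, e k = chart_rays i l.
  move=> k; have /imsetP[l _ ->] : e k \in rays (chart_rays i); last by exists l.
  by apply: (fintype.subsetP sI); apply/imsetP; exists k.
have fi : injective f by move=> k k' h; apply: injE; rewrite !hf h.
by exists i, (perm fi) => k; rewrite permE.
Qed.

Lemma ray_mx_perm (e : {ffun 'I_n -> 'I_(size ray_seq)}) i (s : 'S_n) : (forall k, e k =
    chart_rays i (s k)) ->
  ray_mx ray e = row_perm s (invmx (M i)).
Proof. by move=> h; apply/matrixP => k j; rewrite !mxE h ray_chart mxE. Qed.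

Lemma dual_mx_perm (e : {ffun 'I_n -> 'I_(size ray_seq)}) i (s : 'S_n) : (forall k, e k =
    chart_rays i (s k)) ->
  ray_mx ray e \in unitmx /\ dual_mx ray e = col_perm s (M i).
Proof.
move=> /ray_mx_perm E.
have K1 : ray_mx ray e *m col_perm s (M i) = 1%:M.
  rewrite E row_permE col_permE mulmxA -(mulmxA (perm_mx s)) mulVmx // mulmx1.
  by rewrite -perm_mxM mulgV perm_mx1.
have [u _] := mulmx1_unit K1; split => //.
by rewrite /dual_mx -[LHS]mulmx1 -K1 mulKmx.
Qed.

Section Atlas.
Variables (B : set (chart R n X)) (good : chart R n X -> Prop).
Hypothesis good_holomorphic : forall c, good c -> holomorphic_chart B c.
Hypothesis goodb : forall i, good (b i).
Hypothesis good_perm : forall c (s : 'S_n), good c -> good (perm_chart s c).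

(** The complex structure enters only through [good], which later means that [J] is multiplication
    by i in the chart. *)
Lemma chart_toric_variety : toric_variety_of_fan B act ray chart_cones.
Proof.
have [i0 _] := cover x0.
have /choice[phi hphi] : forall e, exists c, max_cone chart_cones e ->
    [/\ good c, monomial_chart act x0 c (dual_mx ray e) & ray_mx ray e \in unitmx].
  move=> e; have [me|nme] := pselect (max_cone chart_cones e); last by exists (b i0).
  have [i [s es]] := max_coneP me; have [u dE] := dual_mx_perm es.
  exists (perm_chart s (b i)) => _; split => //; first exact: good_perm.
  by rewrite dE; exact: perm_monomial_chart.
(* A row of the transition matrix is a unit vector exactly when its ray is shared by both cones,
   since its entries express that ray in the basis of the other cone. *)
have common e e' k l : max_cone chart_cones e -> max_cone chart_cones e' ->
    (forall j, (ray_mx ray e *m dual_mx ray e') k j = (j == l)%:R) <-> e k = e' l.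
  move=> /hphi[_ _ u] /hphi[_ _ u']; rewrite row_delta row_mul.
  have rowE e1 k1 : row k1 (ray_mx ray e1) = ray (e1 k1) by apply/rowP => j; rewrite !mxE.
  split=> [h|ekl]; last by rewrite rowE ekl -rowE -row_mul mulmxV // row1.
  apply: ray_inj; rewrite -!rowE -[LHS]mulmx1 -(mulVmx u') mulmxA.
  by rewrite -/(dual_mx ray e') h -matrix.rowE.
(* [glueE] and [faceE] are the two inclusions that determine the overlap of two charts. *)
have glueE e e' z : max_cone chart_cones e -> max_cone chart_cones e' ->
    (forall k, crd z k = 0 -> e k \in rays e') ->
    dom (phi e') (from (phi e) z) /\
    to (phi e') (from (phi e) z) = mono (ray_mx ray e *m dual_mx ray e') z.
  move=> me me' h; have [_ m1 u] := hphi e me; have [_ m2 _] := hphi e' me'.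
  have := glue hausX (z := z) m1 m2; rewrite invmxK; apply=> k /h /imsetP[l _ ekl] j.
  by rewrite ((common e e' k l me me').2 ekl) ler0n.
have faceE e e' y k : max_cone chart_cones e -> max_cone chart_cones e' ->
    dom (phi e) y -> dom (phi e') y -> crd (to (phi e) y) k = 0 -> e k \in rays e'.
  move=> me me' d d' yk; have [_ m1 u] := hphi e me; have [_ m2 _] := hphi e' me'.
  have [l] := face m1 m2 d d' yk; rewrite invmxK => hl.
  by apply/imsetP; exists l => //; apply/(common e e' k l me me').
exists phi; split.
- move=> e me; have [g [cT _ _ _] _] := hphi e me; split => //; exact: good_holomorphic.
- move=> y; have [i iy] := cover y; have mi := chart_max_cone i.
  exists (chart_rays i) => //; have [_ m1 _] := hphi _ mi.
  (* The chosen [phi] need not be [b i] itself, but its matrix is [M i]; gluing along the identity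
     matrix shows that its domain contains that of [b i]. *)
  have [] // := glue hausX (z := to (b i) y) (mb i) m1; last by rewrite toK.
  have [|_ ->] := @dual_mx_perm (chart_rays i) i 1%g; first by move=> k; rewrite perm1.
  by rewrite col_permE invg1 perm_mx1 mulmx1 mulVmx // => k _ l; rewrite mxE ler0n.
- move=> e e' me me'; apply/seteqP; split=> [z [y [d d'] <-] k|z hz].
    by apply: contra => /eqP; exact: faceE.
  have [_ m1 _] := hphi e me; have [d1 e1] := mchart_from z m1.
  exists (from (phi e) z) => //; split=> //.
  apply: (glueE e e' z me me' _).1 => k zk; apply: contraT => /(hz k).
  by rewrite zk eqxx.
- move=> e e' y l me me' d d'; rewrite -monoE.
  have [_ <-] : dom (phi e') (from (phi e) (to (phi e) y)) /\
      to (phi e') (from (phi e) (to (phi e) y)) = mono (ray_mx ray e *m dual_mx ray e')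
          (to (phi e) y).
    by apply: glueE => // k; exact: faceE.
  by rewrite toK.
move=> e g y me tg d; have [_ [_ _ _ h] _] := hphi e me.
have [d1 e1] := h g y tg d; split => // l.
by rewrite e1 crdM monoE.
Qed.

End Atlas.
End Fan.

(** * The automorphism that twists the action *)

Section Automorphism.
Variables (R : realType) (n : nat) (X : topologicalType) (A : set (chart R n X)).
Variables (act : Cn R n -> X -> X) (J : forall p, tangent A p -> tangent A p) (x0 : X).
Hypothesis actE : effective_action act.
Hypothesis cover : forall x, exists b psi, toric_chart act J x0 b psi /\ dom b x.

(** Since [g] fixes [x0], which lies at 1 in every toric chart, its value under each [psi'] is 1.
    Hence [g] acts trivially on all charts, and effectiveness applies. *)
Lemma toric_chart_faithful b psi g : toric_chart act J x0 b psi -> torus g ->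
  psi g = tone R n -> g = tone R n.
Proof.
move=> [_ _ _ [_ _ _ stab] _] tg /(stab g tg) gx0; apply: actE => // x.
have [b' [psi' [tb' bx']]] := cover x.
have [_ e1] := toric_chart_orbit tb' tg; rewrite gx0 in e1.
have [_ _ [_ e2] _ h] := tb'.
have [d e] := h g x tg bx'.
by rewrite -[LHS](toK d) e -e1 e2 tmul1 toK.
Qed.

Lemma toric_chart_automorphism b psi : toric_chart act J x0 b psi ->
  exists sigma, [/\ smooth_automorphism psi, forall g, torus g -> torus (sigma g),
    forall g, torus g -> sigma (psi g) = g & forall g, torus g -> psi (sigma g) = g].
Proof.
move=> tb; have [_ _ _ [hpsi dpsi surj _] _] := tb; have [pT pM] := hpsi.
have /choice[sigma hs] : forall t, exists g, torus t -> torus g /\ psi g = t.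
  move=> t; have [tt|nt] := pselect (torus t); last by exists t.
  by have [g tg gt] := surj t tt; exists g.
have sT g : torus g -> torus (sigma g) by move=> /hs[].
have psiK g : torus g -> psi (sigma g) = g by move=> /hs[].
have inj g g' : torus g -> torus g' -> psi g = psi g' -> g = g'.
  move=> tg tg' e; have tV := torusV tg'.
  have := @toric_chart_faithful b psi (tmul (tinv g') g) tb (torusM tV tg).
  rewrite pM // e -pM // tmulV // (hom_tone hpsi) => /(_ erefl) e1.
  by rewrite -[LHS]tmul1 -(tmulV tg') tmulC tmulA (tmulC g) (tmulC _ g') e1 tmulr1.
have sK g : torus g -> sigma (psi g) = g.
  by move=> tg; apply: inj => //; [exact/sT/pT|rewrite psiK //; exact: pT].
have hsigma : torus_hom sigma.
  split=> // g g' tg tg'; apply: inj.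
  - exact/sT/torusM.
  - by apply: torusM; exact: sT.
  - by rewrite psiK ?pM ?psiK //; [exact: sT|exact: sT|exact: torusM].
exists sigma; split => //; split.
  by split => //; exact: hom_smooth.
exists sigma; split; last by move=> g tg; split; [exact: sK|exact: psiK].
by split=> //; [exact: hsigma.2|exact: (hom_inverse_smooth hpsi dpsi hsigma sK)].
Qed.

End Automorphism.

Theorem theorem1p2 (R : realType) (n : nat) (X : topologicalType)
    (A : set (chart R n X)) (act : Cn R n -> X -> X)
    (J : forall p : X, tangent A p -> tangent A p) :
  topological_toric_manifold A act ->
  invariant_almost_complex_structure act J ->
  integrable_structure J /\
  forall B : set (chart R n X), complex_structure_inducing J B ->
  exists (Y : topologicalType) (B' : set (chart R n Y)) (act' : Cn R n -> Y -> Y)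
         (f : X -> Y) (rho : Cn R n -> Cn R n),
    [/\ toric_manifold B' act',
        biholomorphism B B' f,
        smooth_automorphism rho &
        forall (g : Cn R n) (x : X), torus g -> f (act g x) = act' (rho g) (f x)].
Proof.
move=> [[haus comp] atlasA [actT actE _] [x0 [openO denseO]] [N [c [chi [chiP repc cov]]]]]
    [acJ invJ].
have /choice[bp hbp] : forall i, exists bp : chart R n X * (Cn R n -> Cn R n),
    toric_chart act J x0 bp.1 bp.2 /\ dom bp.1 = dom (c i).
  move=> i; have [b [psi h]] :=
    rep_toric_chart atlasA actT acJ invJ openO denseO (repc i) (chiP i).
  by exists (b, psi).
pose b i := (bp i).1; pose psi i := (bp i).2.
have tb i : toric_chart act J x0 (b i) (psi i) := (hbp i).1.
have covb x : exists i, dom (b i) x.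
  by have [i ix] := cov x; exists i; rewrite /b (hbp i).2.
(* Both the constructed charts and those of any [B] inducing [J] are good, and good charts are
   mutually holomorphic; this links them. *)
pose good (d : chart R n X) := smooth_chart A d /\
  (forall p (v : tangent A p), dom d p -> tcoord d (J p v) = mulI (tcoord d v)).
have goodb i : good (b i) by have [] := tb i.
have good_hol d d' : good d -> good d' -> holomorphic_transition d d'.
  by move=> [sd Jd] [sd' Jd']; exact: (commuting_holomorphic atlasA sd sd' Jd Jd').
split.
  exists [set d | exists i, d = b i]; split.
  - split; first by move=> x; have [i ix] := covb x; exists (b i) => //; exists i.
    by move=> _ _ [i ->] [j ->]; exact: good_hol.
  - by move=> _ [i ->]; have [] := goodb i.
  - move=> _ d p v [i ->] Ad bp' dp; have [sb Jb] := goodb i.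
    exact: ((inducing_tcoord atlasA J sb).2 Jb d p v Ad bp' dp).
move=> B [atlasB smoothB JB].
have goodB d : B d -> good d.
  move=> Bd; have sd := smoothB d Bd; split => //.
  by apply/(inducing_tcoord atlasA J sd) => e p v Ae dp ep; exact: JB.
have [i0 _] := covb x0.
have [|sigma [autpsi sT sK psiK]] := toric_chart_automorphism actE _ (tb i0).
  by move=> x; have [i ix] := covb x; exists (b i), (psi i).
have /choice[M hM] : forall i, exists M : 'M[int]_n,
    M \in unitmx /\ forall g, torus g -> psi i g = mono M (psi i0 g).
  move=> i; have [M hM] := toric_transition atlasA (tb i0) (tb i).
  by exists M; split => //; exact: (toric_transition_unit atlasA (tb i0) (tb i) hM).
pose act' g x := act (sigma g) x.
have mb i : monomial_chart act' x0 (b i) (M i).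
  have [_ bT bx [_ _ _ _] h] := tb i; have [uM psiE] := hM i; split => // g x tg bix.
  have [d e] := h (sigma g) x (sT g tg) bix; split => //.
  by rewrite e psiE ?psiK //; exact: sT.
exists X, B, act', id, (psi i0); split.
- split=> //.
  exists (size (ray_seq M)), (@ray n N M), (chart_cones M).
  split; first exact: (chart_fan haus comp mb covb).
  have gB d : good d -> holomorphic_chart B d.
    by move=> gd e Be; split; apply: good_hol; rewrite //; exact: goodB.
  have gperm d (s : 'S_n) : good d -> good (perm_chart s d).
    move=> [sd Jd]; split; first exact: lin_chart_smooth.
    move=> p v dp; rewrite (tcoord_lin atlasA _ _ (J p v) sd dp) (tcoord_lin atlasA _ _ v sd dp).
    rewrite (Jd p v dp).
    by apply: crdP => k; rewrite crd_of !crdI crd_of.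
  exact: (chart_toric_variety haus mb covb gB goodb gperm).
- exists id; split => //; split; try (by move=> x; exact: cvg_id).
  + by move=> d d' Bd Bd'; exact: (atlasB.2 d d' Bd Bd').
  + by move=> d d' Bd Bd'; exact: (atlasB.2 d d' Bd Bd').
- exact: autpsi.
by move=> g x tg; rewrite /act' /= sK.
Qed.
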